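(* Let $\Omega\subset\mathbb{R}^{n+m}$ be a bounded Lipschitz domain, $s\in(0,1)$, $p\in(1,\infty)$. If $u$ is an eigenfunction associated with $\lambda_1(s,p)$, then $|u|>0$ in $\Omega$.
   Context: Points of $\mathbb{R}^{n+m}$ are $(x,y)$, $x\in\mathbb{R}^n$, $y\in\mathbb{R}^m$. $[u]^p_{\mathcal W^{s,p}(\mathbb{R}^{n+m})}=\int_{\mathbb{R}^{n+m}}\int_{\mathbb{R}^n}\frac{|u(x,y)-u(z,y)|^p}{|x-z|^{n+sp}}dz\,dx\,dy+\int_{\mathbb{R}^{n+m}}\int_{\mathbb{R}^m}\frac{|u(x,y)-u(x,w)|^p}{|y-w|^{m+sp}}dw\,dx\,dy$; $\widetilde{\mathcal W}^{s,p}(\Omega)$ is the set of $u\in L^p(\mathbb{R}^{n+m})$ with finite seminorm and $u\equiv0$ outside $\Omega$. With $(a)^{p-1}=|a|^{p-2}a$, $\mathcal H_{s,p}(u,v)=\int_{\mathbb{R}^{n+m}}\int_{\mathbb{R}^n}\frac{(u(x,y)-u(z,y))^{p-1}(v(x,y)-v(z,y))}{|x-z|^{n+sp}}dz\,dx\,dy+\int_{\mathbb{R}^{n+m}}\int_{\mathbb{R}^m}\frac{(u(x,y)-u(x,w))^{p-1}(v(x,y)-v(x,w))}{|y-w|^{m+sp}}dw\,dx\,dy$. A real $\lambda$ is an eigenvalue with eigenfunction $u\in\widetilde{\mathcal W}^{s,p}(\Omega)\setminus\{0\}$ if $\mathcal H_{s,p}(u,v)=\lambda\int_\Omega(u)^{p-1}v$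 for all $v\in\widetilde{\mathcal W}^{s,p}(\Omega)$. $\lambda_1(s,p)=\inf\{[u]^p_{\mathcal W^{s,p}(\mathbb{R}^{n+m})}/\|u\|^p_{L^p(\Omega)}:u\in\widetilde{\mathcal W}^{s,p}(\Omega),u\not\equiv0\}$ is the first (smallest) eigenvalue. *)

(* Defs.v *)
From mathcomp Require Import all_boot all_order all_algebra.
From mathcomp Require Import all_classical all_reals all_analysis.
Import Order.TTheory GRing.Theory Num.Theory.
Import numFieldNormedType.Exports.

Set Implicit Arguments.
Unset Strict Implicit.
Unset Printing Implicit Defensive.

Local Open Scope ring_scope.
Local Open Scope classical_set_scope.

Section Defs.
Variable R : realType.

(* Points of R^k used for integration: k.-tuple R, which carries the   *)
(* product Borel sigma-algebra of mathcomp-analysis.                   *)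
(* Lebesgue integral of a NONNEGATIVE function over R^k, defined as    *)
(* the iterated one-dimensional Lebesgue integral (by Tonelli this is  *)
(* the integral w.r.t. the k-dimensional Lebesgue measure for every    *)
(* nonnegative measurable integrand).                                  *)
Fixpoint iint (k : nat) : (k.-tuple R -> \bar R) -> \bar R :=
  match k return (k.-tuple R -> \bar R) -> \bar R with
  | 0 => fun f => f [tuple]
  | k'.+1 => fun f =>
      (\int[@lebesgue_measure R]_t iint (fun v : k'.-tuple R => f (cons_tuple t v)))%E
  end.

Definition tdist (k : nat) (x z : k.-tuple R) : R :=
  Num.sqrt (\sum_(i < k) (tnth x i - tnth z i) ^+ 2).

Variables n m : nat.

Definition pt := (n.-tuple R * m.-tuple R)%type.

Definition int_nm (F : pt -> \bar R) : \bar R :=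
  iint (fun x : n.-tuple R => iint (fun y : m.-tuple R => F (x, y))).

Definition leb_nm (A : set pt) : \bar R := int_nm (fun q => (\1_A q : R)%:E).

Definition sint_nm (F : pt -> R) : R :=
  fine (int_nm (fun q => (Num.max (F q) 0)%:E))
  - fine (int_nm (fun q => (Num.max (- F q) 0)%:E)).

Definition int_nm_n (G : pt -> n.-tuple R -> \bar R) : \bar R :=
  int_nm (fun q => iint (fun z : n.-tuple R => G q z)).
Definition int_nm_m (G : pt -> m.-tuple R -> \bar R) : \bar R :=
  int_nm (fun q => iint (fun w : m.-tuple R => G q w)).
Definition sint_nm_n (G : pt -> n.-tuple R -> R) : R :=
  fine (int_nm_n (fun q z => (Num.max (G q z) 0)%:E))
  - fine (int_nm_n (fun q z => (Num.max (- G q z) 0)%:E)).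
Definition sint_nm_m (G : pt -> m.-tuple R -> R) : R :=
  fine (int_nm_m (fun q w => (Num.max (G q w) 0)%:E))
  - fine (int_nm_m (fun q w => (Num.max (- G q w) 0)%:E)).

Definition vec_of (q : pt) : 'rV[R]_(n + m) :=
  row_mx (\row_(i < n) tnth q.1 i) (\row_(j < m) tnth q.2 j).

Definition OmS (Om : set 'rV[R]_(n + m)) : set pt := [set q | Om (vec_of q)].

Variables s p : R.

Definition ppow (a : R) : R := `|a| `^ (p - 2) * a.

Definition seminorm (u : pt -> R) : \bar R :=
  (int_nm_n (fun q z =>
      (`|u q - u (z, q.2)| `^ p / tdist q.1 z `^ (n%:R + s * p))%:E)
   + int_nm_m (fun q w =>
      (`|u q - u (q.1, w)| `^ p / tdist q.2 w `^ (m%:R + s * p))%:E))%E.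

Definition Lp_pow (u : pt -> R) : \bar R := int_nm (fun q => (`|u q| `^ p)%:E).

Definition Lp_pow_on (Om : set 'rV[R]_(n + m)) (u : pt -> R) : \bar R :=
  int_nm (fun q => (\1_(OmS Om) q * `|u q| `^ p)%:E).

Definition Wtilde (Om : set 'rV[R]_(n + m)) (u : pt -> R) : Prop :=
  measurable_fun setT u /\ (Lp_pow u < +oo)%E /\ (seminorm u < +oo)%E
  /\ (forall q, ~ OmS Om q -> u q = 0).

Definition ae_zero (u : pt -> R) : Prop := leb_nm [set q | u q != 0] = 0%E.

Definition Hsp (u v : pt -> R) : R :=
  sint_nm_n (fun q z =>
     ppow (u q - u (z, q.2)) * (v q - v (z, q.2)) / tdist q.1 z `^ (n%:R + s * p))
  + sint_nm_m (fun q w =>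
     ppow (u q - u (q.1, w)) * (v q - v (q.1, w)) / tdist q.2 w `^ (m%:R + s * p)).

Definition eigenpair (Om : set 'rV[R]_(n + m)) (lambda : R) (u : pt -> R) : Prop :=
  Wtilde Om u /\ ~ ae_zero u /\
  forall v, Wtilde Om v ->
    Hsp u v = lambda * sint_nm (fun q => \1_(OmS Om) q * ppow (u q) * v q).

Definition lambda1 (Om : set 'rV[R]_(n + m)) : \bar R :=
  ereal_inf [set (fine (seminorm u) / fine (Lp_pow_on Om u))%:E
            | u in [set u | Wtilde Om u /\ ~ ae_zero u]].

End Defs.

Section Lipschitz.
Variable R : realType.

Definition enorm (N : nat) (x : 'rV[R]_N) : R := Num.sqrt (\sum_(i < N) x 0 i ^+ 2).

Definition orthogonal_mx (N : nat) (Q : 'M[R]_N) : Prop := Q *m Q^T = 1%:M.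

(* Omega is a bounded Lipschitz domain: a nonempty bounded connected open
   set whose boundary is locally, after a rigid change of coordinates, the
   graph of a Lipschitz function, with Omega lying on one side of it.
   The "vertical" direction is the coordinate j (any j is allowed: this is
   harmless since Q is an arbitrary orthogonal matrix); gamma depends only
   on the remaining coordinates. *)
Definition bounded_lipschitz_domain (N : nat) (Om : set 'rV[R]_N) : Prop :=
  Om !=set0 /\ open Om /\ connected Om /\ bounded_set Om /\
  forall x0, (closure Om `\` Om) x0 ->
    exists (r : R) (Q : 'M[R]_N) (j : 'I_N) (gamma : 'rV[R]_N -> R) (L : R),
      0 < r /\ orthogonal_mx Q /\
      (forall w w' : 'rV[R]_N, (forall i, i != j -> w 0 i = w' 0 i) -> gamma w = gamma w') /\
      (forall w w' : 'rV[R]_N, `|gamma w - gamma w'| <= L * enorm (w - w')) /\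
      forall x : 'rV[R]_N, enorm (x - x0) < r ->
        (Om x <-> gamma ((x - x0) *m Q) < ((x - x0) *m Q) 0 j).

End Lipschitz.

(* Main.v *)
(** Since [u] attains [lambda1], any [v] with [|u| <= v] has energy at least that
    of [u].  Let [eta] be a tent function supported in a ball [B] of [Om] and
    compare with [v = max(|u|, e * eta)].  Pointwise, the energy density of [v] is
    at most the sum of those of [u] and [e * eta], and for a pair with [u = 0],
    [eta >= h] at one point and [|u| >= h] at the other there is an extra gain
    [e * h ^ p], because [(b - c) ^ p + c * b ^ (p - 1) <= b ^ p].  Hence
    [e * h ^ p * J <= e ^ p * energy eta], where [J] is the kernel integrated over such
    pairs; as [p > 1], letting [e] tend to [0] gives [J = 0].  So almost no move
    along one block of coordinates goes from [B] and [u = 0] to [u <> 0], and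
    passing from [(x, y)] to [(x', y')] through [(x', y)] shows that [u = 0] or
    [u <> 0] is null in [B].  Connectedness of [Om] makes the same alternative
    hold for all balls, and [u] is not almost everywhere zero.

    The tent function has finite energy by splitting the kernel over the dyadic
    shells [2 ^ j <= |x - z| < 2 ^ (j + 1)] and bounding each shell by a cube. *)

Require Import Defs.
From HB Require Import structures.
From mathcomp Require Import all_boot all_order all_algebra.
From mathcomp Require Import all_classical all_reals all_analysis.
From mathcomp Require Import measurable_realfun ring lra.
Import Order.TTheory GRing.Theory Num.Theory.
Import numFieldNormedType.Exports.
Set Implicit Arguments.
Unset Strict Implicit.
Unset Printing Implicit Defensive.
Local Open Scope ring_scope.
Local Open Scope classical_set_scope.

(** * Lebesgue measure on tuples *)

Section sigma_finite_product.
Local Open Scope ereal_scope.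
Context d1 d2 (T1 : measurableType d1) (T2 : measurableType d2) (R : realType).
Variable m1 : {sigma_finite_measure set T1 -> \bar R}.
Variable m2 : {sigma_finite_measure set T2 -> \bar R}.

(* The library's sigma-finite instance on [m1 \x m2] is shadowed by the one for
   subprobabilities, hence this copy. *)
Definition sfprod : set (T1 * T2) -> \bar R := m1 \x m2.

HB.instance Definition _ := Measure.copy sfprod (m1 \x m2).

Let sfprod_sigma_finite : sigma_finite setT sfprod.
Proof.
have /sigma_finiteP[F [TF ndF Foo]] := sigma_finiteT m1.
have /sigma_finiteP[G [TG ndG Goo]] := sigma_finiteT m2.
exists (fun i => F i `*` G i).
  rewrite -setXTT TF TG; apply/seteqP; split => [[x y] [[i _ Fx] [j _ Gy]]|].
    exists (maxn i j) => //; split => /=.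
      by have /subsetPset := ndF _ _ (leq_maxl i j); apply.
    by have /subsetPset := ndG _ _ (leq_maxr i j); apply.
  by move=> [x y] [i _ [Fx Gy]]; split; exists i.
move=> i; have [mF Fi] := Foo i; have [mG Gi] := Goo i; split.
  exact: measurableX.
by rewrite /sfprod product_measure1E// lte_mul_pinfty// ge0_fin_numE.
Qed.

HB.instance Definition _ := Measure_isSigmaFinite.Build _ _ _ sfprod
  sfprod_sigma_finite.

End sigma_finite_product.

Section tuple_measure.
Variable R : realType.
Local Open Scope ereal_scope.

Definition cons_pair k (tv : measurableTypeR R * k.-tuple R) : k.+1.-tuple R :=
  cons_tuple (tv.1 : R) tv.2.

Lemma measurable_cons_pair k : measurable_fun setT (@cons_pair k).
Proof. exact: (measurable_cons (@measurable_fst _ _ _ _) (@measurable_snd _ _ _ _)). Qed.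

Section step.
Variables (k : nat) (mu : {sigma_finite_measure set (k.-tuple R) -> \bar R}).

(** The pushforward splits off the first coordinate, the same recursion as in [iint]. *)
Definition cons_measure : set (k.+1.-tuple R) -> \bar R :=
  pushforward (@lebesgue_measure R \x mu) (@cons_pair k).

Let cons_measure0 : cons_measure set0 = 0.
Proof. by rewrite /cons_measure /pushforward preimage_set0 measure0. Qed.

Let cons_measure_ge0 A : 0 <= cons_measure A.
Proof. exact: (measure_ge0 (@lebesgue_measure R \x mu)). Qed.

Let cons_measure_sigma_additive : semi_sigma_additive cons_measure.
Proof.
pose pm := measure_function_pushforward__canonical__measure_function_Measure
   (@lebesgue_measure R \x mu) (@measurable_cons_pair k).
exact: (@measure_semi_sigma_additive _ _ _ pm).
Qed.

HB.instance Definition _ := isMeasure.Build _ _ _ cons_measure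
  cons_measure0 cons_measure_ge0 cons_measure_sigma_additive.

Let cons_measure_sigma_finite : sigma_finite setT cons_measure.
Proof.
have [F FT Foo] := sigma_finiteT (sfprod (@lebesgue_measure R) mu).
(* [g] inverts [cons_pair]; its preimages carry the finite-measure exhaustion of the product over to
   tuples. *)
pose g (v : k.+1.-tuple R) : measurableTypeR R * k.-tuple R := (thead v, [tuple of behead v]).
have gK x : g (cons_pair x) = x.
  by case: x => t v; rewrite /g /cons_pair; congr pair; apply: val_inj.
have mg : measurable_fun setT g.
  apply: measurable_fun_pair; last exact: measurable_behead.
  exact: (@measurable_tnth _ _ k.+1 ord0).
exists (fun i => g @^-1` F i).
  by rewrite -preimage_bigcup -FT preimage_setT.
move=> i; have [mF Fi] := Foo i; split.
  by rewrite -[X in measurable X]setTI; exact: mg.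
rewrite /cons_measure /pushforward -comp_preimage.
by rewrite (_ : _ \o _ = id) //; apply/funext => x; exact: gK.
Qed.

HB.instance Definition _ := Measure_isSigmaFinite.Build _ _ _ cons_measure
  cons_measure_sigma_finite.
End step.

(** The base case is a Dirac mass because [iint] in dimension 0 is evaluation at the empty tuple.
    Sigma-finiteness is kept in the type so that Tonelli applies at every level of the recursion. *)
Fixpoint tmeas (k : nat) : {sigma_finite_measure set (k.-tuple R) -> \bar R} :=
  match k return {sigma_finite_measure set (k.-tuple R) -> \bar R} with
  | 0 => (\d_([tuple] : 0.-tuple R) : {finite_measure set _ -> \bar R})
  | k'.+1 => cons_measure (tmeas k')
  end.

Lemma tmeasS_integral k (f : k.+1.-tuple R -> \bar R) :
  measurable_fun setT f -> (forall v, 0 <= f v) ->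
  \int[tmeas k.+1]_v f v =
  \int[@lebesgue_measure R]_t \int[tmeas k]_v f (cons_tuple t v).
Proof.
move=> mf f0 /=.
rewrite (ge0_integral_pushforward (@measurable_cons_pair k))//.
rewrite preimage_setT fubini_tonelli1//.
  by apply: measurableT_comp => //; exact: measurable_cons_pair.
by move=> x; exact: f0.
Qed.

(** Induction on the dimension, with Tonelli at each step. This replaces the iterated integrals by
    integrals against one measure. *)
Lemma iintE k (f : k.-tuple R -> \bar R) :
  measurable_fun setT f -> (forall v, 0 <= f v) -> iint f = \int[tmeas k]_v f v.
Proof.
elim: k f => [|k IH] f mf f0.
  rewrite /= integral_dirac// diracT mul1e//.
rewrite tmeasS_integral//=; apply: eq_integral => t _.
rewrite IH//.
apply: measurableT_comp => //.
exact: (measurable_cons (measurable_cst _) (@measurable_id _ _ _)).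
Qed.

(** Cubes serve as balls: they are products of intervals, so their volume is explicit, and they are
    the balls of the sup norm. *)
Definition box k (c : 'I_k -> R) (r : R) : set (k.-tuple R) :=
  [set v | forall i, (`|tnth v i - c i| < r)%R].

Lemma itv_ball (a r : R) :
  [set t : R | (`|t - a| < r)%R] = `](a - r)%R, (a + r)%R[%classic.
Proof.
apply/seteqP; split => t /=; rewrite in_itv/= ltr_norml => /andP[h1 h2]; apply/andP; split; lra.
Qed.

Lemma measurable_box k (c : 'I_k -> R) (r : R) : measurable (box c r).
Proof.
have -> : box c r = \bigcap_(i in [set` 'I_k]) [set v | (`|tnth v i - c i| < r)%R].
  by apply/seteqP; split => [v cv i _|v cv i]; exact: cv.
apply: fin_bigcap_measurable => // i _.
rewrite -[X in measurable X]setTI.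
have -> : [set v : k.-tuple R | (`|tnth v i - c i| < r)%R] =
    (fun v => tnth v i) @^-1` [set t : R | (`|t - c i| < r)%R] by [].
by apply: measurable_tnth => //; rewrite itv_ball; exact: measurable_itv.
Qed.

Lemma tmeas_box k (c : 'I_k -> R) (r : R) : (0 <= r)%R ->
  tmeas k (box c r) = ((r *+ 2) ^+ k)%:E.
Proof.
move=> r0; elim: k c => [|k IH] c.
  have -> : box c r = setT by apply/seteqP; split => // v _ [].
  by rewrite /= diracT.
rewrite /= /cons_measure /pushforward.
have -> : @cons_pair k @^-1` box c r =
    [set t | (`|t - c ord0| < r)%R] `*` box (fun i => c (lift ord0 i)) r.
  apply/seteqP; split => [[t v] /= h|[t v] /= [h0 h] i].
    by split=> [|i]; [exact: (h ord0)|have := h (lift ord0 i); rewrite tnthS].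
  case: (unliftP ord0 i) => [j|] ->; last exact: h0.
  by rewrite tnthS; exact: h.
have mI : measurable ([set t | (`|t - c ord0| < r)%R] : set (measurableTypeR R)).
  by rewrite itv_ball; exact: measurable_itv.
transitivity (lebesgue_measure [set t | (`|t - c ord0| < r)%R] *
    tmeas k (box (fun i => c (lift ord0 i)) r)).
  by apply: product_measure1E => //; exact: measurable_box.
rewrite IH exprS EFinM; congr (_ * _).
rewrite itv_ball lebesgue_measure_itv/= lte_fin.
(* If the interval is empty then [r = 0], and both sides vanish. *)
case: ifPn => [_|]; first by rewrite -EFinD; congr EFin; rewrite mulr2n; ring.
rewrite -leNgt => h; congr EFin; apply/eqP; rewrite eq_le mulrn_wge0//=.
by rewrite mulr2n; lra.
Qed.
End tuple_measure.

(** * Measurability of powers, distances and kernels *)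

Section measurability.
Context d (T : measurableType d) (R : realType).

Lemma measurable_fun_powR (f : T -> R) (a : R) :
  measurable_fun setT f -> measurable_fun setT (fun w => f w `^ a).
Proof. by move=> mf; exact: (measurableT_comp (measurable_powR a) mf). Qed.

Lemma measurable_tdist k (f g : T -> k.-tuple R) :
  measurable_fun setT f -> measurable_fun setT g ->
  measurable_fun setT (fun w => tdist (f w) (g w)).
Proof.
move=> mf mg.
have -> : (fun w => tdist (f w) (g w)) =
    (fun w => (\sum_(i < k) (tnth (f w) i - tnth (g w) i) ^+ 2) `^ 2^-1).
  apply/funext => w; rewrite powR12_sqrt//.
  by apply: sumr_ge0 => i _; exact: sqr_ge0.
apply: measurable_fun_powR.
apply: measurable_sum => i; apply: measurable_funX; apply: measurable_funB.
  by move/measurable_fun_tnthP : mf; exact.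
by move/measurable_fun_tnthP : mg; exact.
Qed.

Lemma measurable_absdiff (f g : T -> R) :
  measurable_fun setT f -> measurable_fun setT g ->
  measurable_fun setT (fun w => `|f w - g w|).
Proof.
by move=> mf mg; apply: measurableT_comp => //; exact: measurable_funB.
Qed.

Lemma measurable_quotient k (f : T -> R) (x z : T -> k.-tuple R) (a : R) :
  measurable_fun setT f -> measurable_fun setT x -> measurable_fun setT z ->
  measurable_fun setT (fun w => f w / tdist (x w) (z w) `^ a).
Proof.
move=> mf mx mz; apply: measurable_funM => //.
(* The inverse becomes a power with negative exponent, an identity that also holds at distance 0. *)
under eq_fun do rewrite -powRN.
by apply: measurable_fun_powR; exact: measurable_tdist.
Qed.

Lemma measurable_set_eq0 (f : T -> R) :
  measurable_fun setT f -> measurable [set x | f x = 0].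
Proof.
move=> mf; rewrite -[X in measurable X]setTI.
by have := mf measurableT [set 0] (measurable_set1 0).
Qed.

Lemma measurable_set_ge (f : T -> R) a :
  measurable_fun setT f -> measurable [set x | a <= f x].
Proof.
move=> mf; rewrite -[X in measurable X]setTI.
have := mf measurableT `[a, +oo[%classic (measurable_itv _).
by congr measurable; congr (_ `&` _); apply/seteqP; split => x /=; rewrite in_itv/= andbT.
Qed.

End measurability.

(** * Iterated integrals as integrals against product measures *)

Section representation.
Variables (R : realType) (n m : nat).
Local Open Scope ereal_scope.
Local Notation T := (n.-tuple R * m.-tuple R)%type.

Definition mupt : {sigma_finite_measure set T -> \bar R} :=
  sfprod (tmeas R n) (tmeas R m).

(** The underlying space consists of a point together with a replacement value for one of its blocks
    of coordinates. *)
Definition muw k : {sigma_finite_measure set (T * k.-tuple R)%type -> \bar R} :=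
  sfprod mupt (tmeas R k).

Lemma int_nmE (F : T -> \bar R) :
  measurable_fun setT F -> (forall q, 0 <= F q) ->
  int_nm F = \int[mupt]_q F q.
Proof.
move=> mF F0; rewrite /int_nm (_ : (fun x => _) = fubini_F (tmeas R m) F).
  rewrite iintE; last 2 first.
  - exact: measurable_fun_fubini_tonelli_F.
  - by move=> v; apply: integral_ge0 => y _; exact: F0.
  by rewrite -fubini_tonelli1.
apply/funext => x; rewrite iintE//.
exact: measurable_fun_pair2.
Qed.

Lemma int_nm_iintE k (G : T -> k.-tuple R -> \bar R) :
  measurable_fun setT (fun w : (T * k.-tuple R)%type => G w.1 w.2) ->
  (forall q z, 0 <= G q z) ->
  int_nm (fun q => iint (G q)) = \int[muw k]_w G w.1 w.2.
Proof.
move=> mG G0.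
rewrite (_ : (fun q => _) = fubini_F (tmeas R k) (fun w => G w.1 w.2)).
  rewrite int_nmE; last 2 first.
  - exact: measurable_fun_fubini_tonelli_F.
  - by move=> v; apply: integral_ge0 => y _; exact: G0.
  by rewrite -fubini_tonelli1.
apply/funext => q; rewrite iintE//.
exact: (@measurable_fun_pair2 _ _ _ _ _ _ (fun w : (T * k.-tuple R)%type => G w.1 w.2)).
Qed.

Lemma leb_nmE (A : set T) : measurable A -> leb_nm A = mupt A.
Proof.
move=> mA; rewrite /leb_nm int_nmE.
- by rewrite integral_indic// setIT.
- by apply/measurable_EFinP; exact: measurable_indic.
- by move=> q; rewrite lee_fin indicE ler0n.
Qed.

End representation.

(** * Energy of the competitor *)

Section pointwise.
Variable R : realType.
Implicit Types a b c d e h p : R.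

Lemma max_lipschitz a b c d :
  `|Num.max a c - Num.max b d| <= Num.max `|a - b| `|c - d|.
Proof.
have h1 : a - b <= `|a - b| by exact: ler_norm.
have h2 : b - a <= `|a - b| by rewrite distrC; exact: ler_norm.
have h3 : c - d <= `|c - d| by exact: ler_norm.
have h4 : d - c <= `|c - d| by rewrite distrC; exact: ler_norm.
set A := `|a - b| in h1 h2 *; set B := `|c - d| in h3 h4 *.
rewrite ler_norml.
case: (leP a c) => ac; case: (leP b d) => bd; case: (leP A B) => AB;
  apply/andP; split; lra.
Qed.

(** The increment of a maximum is at most the larger of the two increments, and the power of the
    larger one is at most the sum of both powers. *)
Lemma max_energy a b c d p : 0 <= p ->
  `|Num.max `|a| c - Num.max `|b| d| `^ p <= `|a - b| `^ p + `|c - d| `^ p.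
Proof.
move=> p0; apply: (@le_trans _ _ (Num.max `|a - b| `|c - d| `^ p)).
  have H : `|Num.max `|a| c - Num.max `|b| d| <= Num.max `|a - b| `|c - d|.
    apply: (le_trans (max_lipschitz _ _ _ _)).
    by rewrite ge_max !le_max lexx ler_dist_dist orbT.
  by apply: ge0_ler_powR => //; rewrite nnegrE// (le_trans _ H).
by case: (leP `|a - b| `|c - d|) => _; rewrite ?lerDl ?lerDr powR_ge0.
Qed.

(** Write [(b - c) ^ p] as [(b - c) * (b - c) ^ (p - 1)] and bound the second factor by
    [b ^ (p - 1)]. *)
Lemma powR_sub_le b c p : 1 <= p -> 0 < c <= b ->
  (b - c) `^ p + c * b `^ (p - 1) <= b `^ p.
Proof.
move=> p1 /andP[c0 cb]; have b0 : 0 <= b by lra.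
have p0 : 0 < p by lra.
rewrite -(mulr_powRB1 b0 p0) -lerBrDr -mulrBl -(@mulr_powRB1 _ (b - c)) ?subr_ge0//.
apply: ler_wpM2l; first by rewrite subr_ge0.
by apply: ge0_ler_powR; rewrite ?nnegrE; lra.
Qed.

(** The maxima are [c] and [|b|], so the increment shrinks from [|b|] to [|b| - c]. By [powR_sub_le]
    this saves [c * |b| ^ (p - 1)], which is at least [(e * h) * h ^ (p - 1)]. *)
Lemma max_energy_gain b c d e h p : 1 <= p -> 0 < h -> 0 < e -> e * h <= c ->
    c <= h -> d <= h -> h <= `|b| ->
  `|Num.max `|0 : R| c - Num.max `|b| d| `^ p + e * h `^ p <= `|0 - b| `^ p.
Proof.
move=> p1 h0 e0 ehc ch dh hb.
have eh0 : 0 < e * h by rewrite mulr_gt0.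
rewrite normr0 max_r; last by lra.
rewrite max_l; last by lra.
rewrite sub0r normrN distrC ger0_norm; last by lra.
apply: le_trans (powR_sub_le p1 (_ : 0 < c <= `|b|)); last by apply/andP; split; lra.
rewrite lerD2l -(@mulr_powRB1 _ h p) ?(ltW h0)//; last by lra.
rewrite mulrA; apply: ler_pM; rewrite ?powR_ge0 ?(ltW eh0)//.
by apply: ge0_ler_powR => //; rewrite ?nnegrE; lra.
Qed.

End pointwise.

Section energy.
Variables (R : realType) (n m k : nat).
Local Open Scope ereal_scope.
Local Notation T := (n.-tuple R * m.-tuple R)%type.
Variables (pr : T -> k.-tuple R) (sub : (T * k.-tuple R)%type -> T).
Hypotheses (mpr : measurable_fun setT pr) (msub : measurable_fun setT sub).
Variables (a p : R).
Hypothesis p1 : (1 < p)%R.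

(** Both halves of the seminorm are instances: [pr] reads off one block of coordinates and [sub]
    replaces that block by the second component of the pair. *)
Definition energy (u : T -> R) : \bar R := \int[muw R n m k]_w
  (`|u w.1 - u (sub w)| `^ p / tdist (pr w.1) w.2 `^ a)%:E.

Lemma measurable_integrand (f : (T * k.-tuple R)%type -> R) :
  measurable_fun setT f ->
  measurable_fun setT (fun w => (f w / tdist (pr w.1) w.2 `^ a)%:E).
Proof.
move=> mf; apply/measurable_EFinP; apply: measurable_quotient => //.
exact: measurableT_comp.
Qed.

Lemma measurable_energy (u : T -> R) : measurable_fun setT u ->
  measurable_fun setT (fun w : (T * k.-tuple R)%type =>
    `|u w.1 - u (sub w)| `^ p)%R.
Proof.
move=> mu; apply: measurable_fun_powR; apply: measurable_absdiff.
  exact: measurableT_comp.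
exact: measurableT_comp.
Qed.

(** The pairs to which [max_energy_gain] applies, with [c] and [d] the values of [e * eta] at the
    two points. *)
Definition gain_set (u eta : T -> R) (h : R) : set (T * k.-tuple R)%type :=
  [set w | (u w.1 = 0 /\ h <= eta w.1 /\ h <= `|u (sub w)|)%R].

Lemma measurable_gain_set (u eta : T -> R) (h : R) :
  measurable_fun setT u -> measurable_fun setT eta -> measurable (gain_set u eta h).
Proof.
move=> mu meta.
have -> : gain_set u eta h = [set w | (u w.1 = 0)%R] `&`
    ([set w | (h <= eta w.1)%R] `&` [set w | (h <= `|u (sub w)|)%R]) by [].
apply: measurableI.
  by apply: measurable_set_eq0; exact: measurableT_comp.
apply: measurableI; apply: measurable_set_ge; first exact: measurableT_comp.
by do 2 apply: measurableT_comp => //.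
Qed.

Definition cross_energy (u eta : T -> R) (h : R) : \bar R := \int[muw R n m k]_w
  (\1_(gain_set u eta h) w / tdist (pr w.1) w.2 `^ a)%:E.

Lemma energy_ge0 u : 0 <= energy u.
Proof.
by apply: integral_ge0 => w _; rewrite lee_fin divr_ge0 ?powR_ge0.
Qed.

Lemma cross_energy_ge0 u eta h : 0 <= cross_energy u eta h.
Proof.
by apply: integral_ge0 => w _; rewrite lee_fin divr_ge0 ?powR_ge0.
Qed.

Lemma integral_quotient_lin (f g : (T * k.-tuple R)%type -> R) (c : R) :
  measurable_fun setT f -> measurable_fun setT g ->
  (forall w, 0 <= f w)%R -> (forall w, 0 <= g w)%R -> (0 <= c)%R ->
  \int[muw R n m k]_w (f w / tdist (pr w.1) w.2 `^ a)%:E +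
    c%:E * \int[muw R n m k]_w (g w / tdist (pr w.1) w.2 `^ a)%:E =
  \int[muw R n m k]_w ((f w + c * g w) / tdist (pr w.1) w.2 `^ a)%:E.
Proof.
move=> mf mg f0 g0 c0.
have H (h : (T * k.-tuple R)%type -> R) w : (forall w, 0 <= h w)%R ->
    0 <= (h w / tdist (pr w.1) w.2 `^ a)%:E.
  by move=> h0; rewrite lee_fin divr_ge0 ?powR_ge0.
have mfE := measurable_integrand mf; have mgE := measurable_integrand mg.
rewrite -ge0_integralZl_EFin//; last by move=> w _; exact: H.
rewrite -ge0_integralD//.
- by apply: eq_integral => w _; rewrite mulrDl -mulrA EFinD EFinM.
- by move=> w _; exact: H.
- by move=> w _; rewrite mule_ge0 ?lee_fin//; exact: H.
- by apply: emeasurable_funM.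
Qed.

(** Integrates the pointwise bounds. Both sides are sums, with no subtraction, so the inequality
    makes sense even when energies are infinite. *)
Lemma energy_max_gain (u eta : T -> R) (e h : R) :
  measurable_fun setT u -> measurable_fun setT eta ->
  (0 < h)%R -> (0 < e)%R -> (forall q, 0 <= eta q)%R -> (forall q, e * eta q <= h)%R ->
  energy (fun q => Num.max `|u q| (e * eta q))%R +
    (e * h `^ p)%:E * cross_energy u eta h
  <= energy u + (e `^ p)%:E * energy eta.
Proof.
move=> mu meta h0 e0 eta0 etah.
set M := (fun q => Num.max _ _); have ME : M = (fun q => Num.max `|u q| (e * eta q))%R by [].
clearbody M.
have mM : measurable_fun setT M.
  rewrite ME; apply: measurable_maxr; first exact: measurableT_comp.
  exact: measurable_funM.
have mS : measurable_fun setT (\1_(gain_set u eta h) : _ -> R).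
  by apply: measurable_indic; exact: measurable_gain_set.
have mMe := measurable_energy mM; have mue := measurable_energy mu.
have mee := measurable_energy meta.
have S0 w : (0 <= \1_(gain_set u eta h) w :> R)%R by rewrite indicE ler0n.
have eh0 : (0 <= e * h `^ p)%R by rewrite mulr_ge0 ?powR_ge0 ?(ltW e0).
rewrite /energy /cross_energy.
have L1 := integral_quotient_lin mMe mS (fun=> powR_ge0 _ _) S0 eh0.
rewrite [leLHS]L1.
have L2 := integral_quotient_lin mue mee (fun=> powR_ge0 _ _) (fun=> powR_ge0 _ _)
  (powR_ge0 e p).
rewrite [leRHS]L2.
apply: ge0_le_integral => //.
- by move=> w _; rewrite lee_fin divr_ge0 ?powR_ge0// addr_ge0 ?powR_ge0//
    mulr_ge0 ?mulr_ge0 ?powR_ge0 ?(ltW e0)// indicE ler0n.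
- apply: measurable_integrand; apply: measurable_funD => //.
  exact: measurable_funM.
- apply: measurable_integrand; apply: measurable_funD => //.
  exact: measurable_funM.
move=> [q z] _; set q' := sub (q, z) => /=.
rewrite lee_fin ler_wpM2r ?invr_ge0 ?powR_ge0//.
have E : (e `^ p * `|eta q - eta q'| `^ p = `|e * eta q - e * eta q'| `^ p)%R.
  by rewrite -mulrBr normrM (gtr0_norm e0) powRM ?(ltW e0).
(* Off the gain set [max_energy] suffices; on it the increment of [u] alone pays for the gain, and
   the energy of [eta] is simply discarded. *)
rewrite E indicE; have [/set_mem [/= u0 [heta hu]]|_] := boolP (_ \in _); last first.
  rewrite mulr0 addr0 ME; apply: max_energy; exact: (le_trans ler01 (ltW p1)).
rewrite mulr1 ME u0; apply: (@le_trans _ _ (`|0 - u q'| `^ p)%R); last first.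
  by rewrite lerDl powR_ge0.
apply: max_energy_gain => //; first exact: ltW.
by rewrite ler_wpM2l// ltW.
Qed.
End energy.

(** * Integrability of the kernel *)

Section dyadic.
Variable R : realType.

Lemma dyadic_bracket (y : R) : 1 <= y -> exists j, 2 ^+ j <= y < 2 ^+ j.+1.
Proof.
move=> y1.
(* The exponent sought is one less than the smallest [i] with [y < 2 ^ i]; that [i] is not 0 because
   [y >= 1]. *)
have ex : exists i, y < 2 ^+ i by exists (Num.bound y); exact: upper_nthrootP.
case: (ex_minnP ex) => -[|j] yj jmin; first by rewrite expr0 in yj; lra.
exists j; rewrite yj andbT leNgt; apply/negP => /jmin.
by rewrite ltnn.
Qed.

Lemma exprn_powR (x r : R) j : 0 <= x -> (x ^+ j) `^ r = (x `^ r) ^+ j.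
Proof.
by move=> x0; rewrite -[in LHS]powR_mulrn// powRAC powR_mulrn ?powR_ge0.
Qed.

Lemma powR_lt1 (x r : R) : 0 <= x < 1 -> 0 < r -> x `^ r < 1.
Proof.
move=> /andP[x0 x1] r0; rewrite -[ltRHS](congr1 (@^~ r) (powR1 R)).
by apply: gt0_ltr_powR; rewrite ?nnegrE.
Qed.

Lemma tdist_ge0 k (x z : k.-tuple R) : 0 <= tdist x z.
Proof. exact: sqrtr_ge0. Qed.

Lemma tdistC k (x z : k.-tuple R) : tdist x z = tdist z x.
Proof.
by congr Num.sqrt; apply: eq_bigr => i _; rewrite -sqrrN opprB.
Qed.

Lemma tdist_coord k (x z : k.-tuple R) i : `|tnth x i - tnth z i| <= tdist x z.
Proof.
rewrite -sqrtr_sqr ler_wsqrtr// (bigD1 i)//= lerDl.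
by apply: sumr_ge0 => j _; exact: sqr_ge0.
Qed.

(** The function is dominated by the sum over [j] of [D j] times the indicator of a cube of
    half-side [rho j] around [x], which contains the Euclidean ball of that radius. Integrating term
    by term gives a geometric series. *)
Lemma integral_le_geometric k (x : k.-tuple R) (f : k.-tuple R -> R)
    (D rho : nat -> R) (c t : R) :
  measurable_fun setT f -> (forall z, 0 <= f z) ->
  (forall z, f z != 0 -> exists j, f z <= D j /\ tdist x z < rho j) ->
  (forall j, 0 <= D j) -> (forall j, 0 <= rho j) ->
  (forall j, D j * (rho j *+ 2) ^+ k <= c * t ^+ j) -> 0 <= c -> 0 < t < 1 ->
  (\int[tmeas R k]_z (f z)%:E <= (c / (1 - t))%:E)%E.
Proof.
move=> mf f0 fD D0 rho0 Dc c0 /andP[t0 t1].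
pose B j := box (tnth x) (rho j).
pose g j (z : k.-tuple R) : \bar R := ((D j)%:E * (\1_(B j) z)%:E)%E.
have mB j : measurable (B j) by exact: measurable_box.
have m1 j : measurable_fun setT (fun z => (\1_(B j) z : R)%:E).
  by apply/measurable_EFinP; exact: measurable_indic.
have i0 j z : (0 <= (\1_(B j) z : R)%:E)%E by rewrite lee_fin indicE ler0n.
have g0 j z : (0 <= g j z)%E by rewrite mule_ge0// lee_fin.
have mg j : measurable_fun setT (g j) by exact: emeasurable_funM.
apply: (@le_trans _ _ (\int[tmeas R k]_z (\sum_(0 <= j <oo) g j z))%E).
  apply: ge0_le_integral => //.
  - by move=> z _; rewrite lee_fin.
  - exact/measurable_EFinP.
  - by apply: ge0_emeasurable_sum.
  move=> z _; have [->|/fD[j [fj dj]]] := eqVneq (f z) 0.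
    by apply: nneseries_ge0.
  (* The partial sum of length [j.+1] is the first to contain the term of index [j], which alone
     dominates [f z]. *)
  apply: le_trans (nneseries_lim_ge j.+1 _) => //.
  rewrite big_nat_recr//= -[leLHS]add0e leeD//.
    by apply: sume_ge0.
  rewrite /g indicE mem_set ?mule1 ?lee_fin// => i.
  by rewrite distrC; exact: le_lt_trans (tdist_coord _ _ _) dj.
rewrite integral_nneseries//.
apply: lime_le; first by apply: is_cvg_nneseries => j _ _; exact: integral_ge0.
near=> N; apply: (@le_trans _ _ (series (geometric c t) N)%:E).
  rewrite /series/= -sumEFin; apply: lee_sum => j _.
  rewrite ge0_integralZl_EFin//.
  rewrite integral_indic// setIT [X in (_ * X)%E](tmeas_box _ (rho0 j)) -EFinM lee_fin.
  exact: Dc.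
by rewrite lee_fin geometric_le_lim// ger0_norm// ltW.
Unshelve. all: by end_near. Qed.

Section kernel.
Variables (k : nat) (s p : R).
Hypotheses (s01 : 0 < s < 1) (p1 : 1 < p).
Let a := k%:R + s * p.

Let p0 : 0 < p. Proof. exact: lt_trans ltr01 p1. Qed.
Let sp0 : 0 < s * p. Proof. by case/andP : s01 => ? _; rewrite mulr_gt0. Qed.
Let a0 : 0 < a. Proof. by rewrite ltr_wpDl. Qed.
Let r0 : 0 < p * (1 - s).
Proof. by case/andP : s01 => _ ?; rewrite mulr_gt0// subr_gt0. Qed.

(** Bounds the energy density of any function that is 1-Lipschitz with oscillation at most 1, in
    particular of a tent. *)
Definition tkernel (x z : k.-tuple R) : R := Num.min 1 (tdist x z) `^ p / tdist x z `^ a.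

Lemma tkernel_ge0 x z : 0 <= tkernel x z.
Proof. by rewrite divr_ge0 ?powR_ge0. Qed.

Lemma measurable_tkernel d (T : measurableType d) (f g : T -> k.-tuple R) :
  measurable_fun setT f -> measurable_fun setT g ->
  measurable_fun setT (fun w => tkernel (f w) (g w)).
Proof.
move=> mf mg; apply: measurable_quotient => //; apply: measurable_fun_powR.
by apply: measurable_minr => //; exact: measurable_tdist.
Qed.

Let near (x z : k.-tuple R) : R := if tdist x z < 1 then tkernel x z else 0.
Let far (x z : k.-tuple R) : R := if tdist x z < 1 then 0 else tkernel x z.

Let mlt x : measurable_fun setT (fun z : k.-tuple R => tdist x z < 1).
Proof. by apply: measurable_fun_ltr => //; exact: measurable_tdist. Qed.

(** On the shell [2 ^ -(j + 1) < d <= 2 ^ -j] the kernel times the volume of the cube is of order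
    [2 ^ (-j * (p + k - a))], and [p + k - a = p * (1 - s)] is positive because [s < 1]. *)
Lemma near_bound x : (\int[tmeas R k]_z (near x z)%:E <=
    (4 ^+ k * 2 `^ a / (1 - 2^-1 `^ (p * (1 - s))))%:E)%E.
Proof.
set t := 2^-1 `^ (p * (1 - s)).
pose T j : R := 2^-1 ^+ j.
have T0 j : 0 < T j by rewrite exprn_gt0// invr_gt0.
(* The radius is doubled because the upper bound on the shell is not strict while
   [integral_le_geometric] asks for a strict one; this gives the factor [4 ^ k]. The factor [2 ^ a]
   comes from the inner radius [T j / 2]. *)
apply: (@integral_le_geometric _ x (near x)
  (fun j => T j `^ p / (T j / 2) `^ a) (fun j => T j *+ 2)).
- by apply: measurable_fun_ifT => //; exact: measurable_tkernel.
- by move=> z; rewrite /near; case: ifP => // _; exact: tkernel_ge0.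
- move=> z; rewrite /near; case: ifPn => [d1|_]; last by rewrite eqxx.
  have [d0|dn0 _] := eqVneq (tdist x z) 0.
    by rewrite /tkernel d0 min_r ?ler01// (powR0 (lt0r_neq0 p0)) mul0r eqxx.
  have d0 : 0 < tdist x z by rewrite lt_neqAle eq_sym dn0 tdist_ge0.
  have [|j /andP[j1 j2]] := @dyadic_bracket (tdist x z)^-1.
    by rewrite invf_ge1// ltW.
  have dT : tdist x z <= T j.
    by rewrite /T exprVn -[leLHS]invrK lef_pV2 ?posrE ?exprn_gt0 ?invr_gt0.
  have Td : T j / 2 < tdist x z.
    rewrite /T exprVn -invfM -exprSr -[ltRHS]invrK ltf_pV2 ?posrE ?exprn_gt0 ?invr_gt0//.
  exists j; split; last by rewrite mulr2n; have := T0 j; lra.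
  rewrite /tkernel min_r ?(ltW d1)//; apply: ler_pM; rewrite ?powR_ge0 ?invr_ge0 ?powR_ge0//.
    by apply: ge0_ler_powR; rewrite ?nnegrE ?(ltW p0) ?(ltW d0) ?(ltW (T0 j)).
  rewrite lef_pV2 ?posrE ?powR_gt0 ?divr_gt0//.
  by apply: ge0_ler_powR; rewrite ?nnegrE ?(ltW a0) ?(ltW d0) ?(ltW Td) ?divr_ge0 ?(ltW (T0 j)).
- by move=> j; rewrite divr_ge0 ?powR_ge0.
- by move=> j; rewrite mulrn_wge0// ltW.
- move=> j.
  have Tn0 : T j != 0 by rewrite gt_eqF.
  have -> : t ^+ j = T j `^ (p * (1 - s)) by rewrite exprn_powR.
  have -> : p * (1 - s) = (p + k%:R) - a by rewrite /a; ring.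
  rewrite powRB ?Tn0 ?implybT// powRD ?Tn0 ?implybT// powR_mulrn ?(ltW (T0 j))//.
  rewrite powRM ?invr_ge0 ?(ltW (T0 j))//.
  rewrite -mulrnA -[T j *+ _]mulr_natl exprMn.
  have -> : 2^-1 `^ a = (2 `^ a)^-1.
    by rewrite -powR_inv1// -powRrM mulN1r powRN.
  rewrite invfM invrK.
  rewrite (_ : (2 * 2)%:R = 4)//.
  by rewrite le_eqVlt; apply/orP; left; apply/eqP; ring.
- by rewrite mulr_ge0 ?powR_ge0 ?exprn_ge0.
- rewrite powR_gt0 ?invr_gt0//= powR_lt1// invr_ge0 ler0n/= invf_lt1//; lra.
Qed.

(** Here the numerator is 1, and the shell [2 ^ j <= d < 2 ^ (j + 1)] contributes of order
    [2 ^ (j * (k - a))], where [k - a = - (s * p)] is negative because [s > 0]. *)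
Lemma far_bound x : (\int[tmeas R k]_z (far x z)%:E <=
    (4 ^+ k / (1 - 2 `^ (- (s * p))))%:E)%E.
Proof.
set t := 2 `^ (- (s * p)).
pose T j : R := 2 ^+ j.
have T0 j : 0 < T j by rewrite exprn_gt0.
apply: (@integral_le_geometric _ x (far x)
  (fun j => (T j `^ a)^-1) (fun j => T j *+ 2)).
- by apply: measurable_fun_ifT => //; exact: measurable_tkernel.
- by move=> z; rewrite /far; case: ifP => // _; exact: tkernel_ge0.
- move=> z; rewrite /far; case: ifPn => [|]; first by rewrite eqxx.
  rewrite -leNgt => d1 _.
  have [j /andP[j1 j2]] := dyadic_bracket d1.
  exists j; split; last by rewrite mulr2n -mulr2n -mulr_natl -exprS.
  rewrite /tkernel min_l// powR1 mul1r lef_pV2 ?posrE ?powR_gt0//; last by lra.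
  by apply: ge0_ler_powR; rewrite ?nnegrE ?(ltW a0) ?(ltW (T0 j)) ?tdist_ge0.
- by move=> j; rewrite invr_ge0 powR_ge0.
- by move=> j; rewrite mulrn_wge0// ltW.
- move=> j.
  have Tn0 : T j != 0 by rewrite gt_eqF.
  have -> : t ^+ j = T j `^ (- (s * p)) by rewrite exprn_powR.
  have -> : - (s * p) = k%:R - a by rewrite /a; ring.
  rewrite powRB ?Tn0 ?implybT// powR_mulrn ?(ltW (T0 j))//.
  rewrite -mulrnA -[T j *+ _]mulr_natl exprMn (_ : (2 * 2)%:R = 4)//.
  by rewrite le_eqVlt; apply/orP; left; apply/eqP; ring.
- by rewrite exprn_ge0.
- rewrite /t powR_gt0//= powRN invf_lt1 ?powR_gt0//.
  rewrite -[ltLHS](congr1 (@^~ (s * p)) (powR1 R)).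
  by apply: gt0_ltr_powR; rewrite ?nnegrE ?ltr1n.
Qed.

(** The bound is uniform in [x], so it can be integrated over a set of finite measure. *)
Lemma tkernel_bound : exists C : R, forall x,
  (\int[tmeas R k]_z (tkernel x z)%:E <= C%:E)%E.
Proof.
exists (4 ^+ k * 2 `^ a / (1 - 2^-1 `^ (p * (1 - s))) +
        4 ^+ k / (1 - 2 `^ (- (s * p)))) => x.
have -> : (fun z => (tkernel x z)%:E) = (fun z => (near x z)%:E + (far x z)%:E)%E.
  by apply/funext => z; rewrite /near /far; case: ifP => _; rewrite ?adde0 ?add0e.
rewrite ge0_integralD//.
- by rewrite EFinD leeD ?near_bound ?far_bound.
- by move=> z _; rewrite lee_fin /near; case: ifP => // _; exact: tkernel_ge0.
- by apply/measurable_EFinP; apply: measurable_fun_ifT => //; exact: measurable_tkernel.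
- by move=> z _; rewrite lee_fin /far; case: ifP => // _; exact: tkernel_ge0.
- by apply/measurable_EFinP; apply: measurable_fun_ifT => //; exact: measurable_tkernel.
Qed.

End kernel.
End dyadic.

(** * Tent functions *)

Section tent.
Variables (R : realType) (n m : nat).
Local Notation T := (n.-tuple R * m.-tuple R)%type.
Implicit Types (c : 'rV[R]_(n + m)) (q : T) (r : R).

Lemma measurable_bigmax d (S : measurableType d) (I : Type) (l : seq I)
    (f : I -> S -> R) : (forall i, measurable_fun setT (f i)) ->
  measurable_fun setT (fun t => \big[Num.max/0]_(i <- l) f i t).
Proof.
move=> mf; elim: l => [|i l IH].
  by under eq_fun do rewrite big_nil; exact: measurable_cst.
by under eq_fun do rewrite big_cons; exact: measurable_maxr.
Qed.

Lemma vec_of_lshift q i : vec_of q 0 (lshift m i) = tnth q.1 i.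
Proof. by rewrite row_mxEl mxE. Qed.

Lemma vec_of_rshift q j : vec_of q 0 (rshift n j) = tnth q.2 j.
Proof. by rewrite row_mxEr mxE. Qed.

Lemma norm_rV_leP (v : 'rV[R]_(n + m)) a : 0 <= a ->
  (`|v| <= a <-> forall i, `|v 0 i| <= a).
Proof.
move=> a0; rewrite [`|v|]mx_normrE; split.
  by move=> /bigmax_leP[_ h] i; exact: (h (0, i)).
by move=> h; apply/bigmax_leP; split => // -[i j] _ /=; rewrite ord1.
Qed.

Lemma norm_rV_ltP (v : 'rV[R]_(n + m)) a : 0 < a ->
  (`|v| < a <-> forall i, `|v 0 i| < a).
Proof.
move=> a0; rewrite [`|v|]mx_normrE; split.
  by move=> /bigmax_ltP[_ h] i; exact: (h (0, i)).
by move=> h; apply/bigmax_ltP; split => // -[i j] _ /=; rewrite ord1.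
Qed.

Definition cfst c : 'I_n -> R := fun i => c 0 (lshift m i).
Definition csnd c : 'I_m -> R := fun j => c 0 (rshift n j).

(** The norm on row vectors is the sup norm, so a ball is a product of two cubes. Hence coordinate
    blocks of two points of a ball can be mixed without leaving it. *)
Lemma norm_vec_of_ltP c r q : 0 < r ->
  (`|vec_of q - c| < r <-> box (cfst c) r q.1 /\ box (csnd c) r q.2).
Proof.
move=> r0; rewrite norm_rV_ltP//; split.
  move=> h; split=> i.
    have := h (lshift m i); rewrite [X in `|X|]mxE [X in _ + X]mxE.
    by rewrite vec_of_lshift.
  have := h (rshift n i); rewrite [X in `|X|]mxE [X in _ + X]mxE.
  by rewrite vec_of_rshift.
move=> [h1 h2] i; rewrite [X in `|X|]mxE [X in _ + X]mxE.
case: (split_ordP i) => j ->; first by rewrite vec_of_lshift; exact: h1.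
by rewrite vec_of_rshift; exact: h2.
Qed.

Lemma norm_vec_of_sub q q' a : 0 <= a ->
  (forall i, `|tnth q.1 i - tnth q'.1 i| <= a) ->
  (forall j, `|tnth q.2 j - tnth q'.2 j| <= a) ->
  `|vec_of q - vec_of q'| <= a.
Proof.
move=> a0 h1 h2; apply/norm_rV_leP => // i.
case: (split_ordP i) => j ->.
  by rewrite [X in `|X|]mxE [X in _ + X]mxE !vec_of_lshift.
by rewrite [X in `|X|]mxE [X in _ + X]mxE !vec_of_rshift.
Qed.

Lemma measurable_norm_vec_of c :
  measurable_fun setT (fun q : T => `|vec_of q - c|).
Proof.
under eq_fun do rewrite [`|_|]mx_normrE.
apply: measurable_bigmax => -[i j] /=; apply: measurableT_comp => //.
rewrite ord1; under eq_fun do rewrite mxE.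
apply: measurable_funD => //; case: (split_ordP j) => l ->.
  under eq_fun do rewrite vec_of_lshift.
  exact: (measurableT_comp (@measurable_tnth _ _ _ l) measurable_fst).
under eq_fun do rewrite vec_of_rshift.
exact: (measurableT_comp (@measurable_tnth _ _ _ l) measurable_snd).
Qed.

Definition tent c r q : R := Num.max 0 (r - `|vec_of q - c|).

Lemma tent_ge0 c r q : 0 <= tent c r q.
Proof. by rewrite le_max lexx. Qed.

Lemma tent_le c r q : 0 < r -> tent c r q <= r.
Proof. by move=> r0; rewrite ge_max (ltW r0) gerBl normr_ge0. Qed.

Lemma tent_gt0 c r q : (0 < tent c r q) = (`|vec_of q - c| < r).
Proof. by rewrite lt_max ltxx subr_gt0. Qed.

Lemma measurable_tent c r : measurable_fun setT (tent c r : T -> R).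
Proof.
apply: measurable_maxr => //; apply: measurable_funB => //.
exact: measurable_norm_vec_of.
Qed.

Lemma tent_lipschitz c r q q' : `|tent c r q - tent c r q'| <= `|vec_of q - vec_of q'|.
Proof.
apply: (le_trans (max_lipschitz _ _ _ _)); rewrite subrr normr0.
rewrite ge_max normr_ge0/= opprB addrC addrA subrK.
by rewrite (le_trans (ler_dist_dist _ _))// distrC opprB addrA subrK.
Qed.

(** The bound is the numerator base of [tkernel]: height at most 1 gives one half of the minimum,
    the Lipschitz property the other. *)
Lemma tent_diff_le c r q q' a : 0 < r <= 1 -> 0 <= a ->
  (forall i, `|tnth q.1 i - tnth q'.1 i| <= a) ->
  (forall j, `|tnth q.2 j - tnth q'.2 j| <= a) ->
  `|tent c r q - tent c r q'| <= Num.min 1 a.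
Proof.
move=> /andP[r0 r1] a0 h1 h2; rewrite le_min; apply/andP; split.
  have := tent_ge0 c r q; have := tent_ge0 c r q'.
  have := tent_le c q r0; have := tent_le c q' r0.
  by move=> *; rewrite ler_norml; apply/andP; split; lra.
exact: le_trans (tent_lipschitz _ _ _ _) (norm_vec_of_sub a0 h1 h2).
Qed.

End tent.

(** * Finite energy of tent functions *)

Section tent_energy.
Variables (R : realType) (s p : R).
Hypotheses (s01 : 0 < s < 1) (p1 : 1 < p).
Local Open Scope ereal_scope.

Lemma tkernelC k (x z : k.-tuple R) : tkernel s p x z = tkernel s p z x.
Proof. by rewrite /tkernel tdistC. Qed.

Section one_block.
Variables (k : nat) (I : set (k.-tuple R)).
Hypotheses (mI : measurable I) (Ioo : tmeas R k I < +oo).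
Local Notation mu := (tmeas R k).

Let m1 d (S : measurableType d) (f : S -> k.-tuple R) : measurable_fun setT f ->
  measurable_fun setT (fun w => \1_I (f w) : R).
Proof.
by move=> mf; apply: (measurableT_comp _ mf); exact: measurable_indic.
Qed.

Let m1k : measurable_fun setT
  (fun w : (k.-tuple R * k.-tuple R)%type => (\1_I w.1 * tkernel s p w.1 w.2)%:E).
Proof.
apply/measurable_EFinP; apply: measurable_funM; first exact: m1.
exact: measurable_tkernel.
Qed.

Let m2k : measurable_fun setT
  (fun w : (k.-tuple R * k.-tuple R)%type => (\1_I w.2 * tkernel s p w.1 w.2)%:E).
Proof.
apply/measurable_EFinP; apply: measurable_funM; first exact: m1.
exact: measurable_tkernel.
Qed.

Let ge0 (x y z : k.-tuple R) : 0 <= (\1_I x * tkernel s p y z)%:E.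
Proof. by rewrite lee_fin mulr_ge0 ?tkernel_ge0// indicE ler0n. Qed.

Lemma left_kernel_lty : \int[mu]_x \int[mu]_z (\1_I x * tkernel s p x z)%:E < +oo.
Proof.
have [C HC] := @tkernel_bound R k s p s01 p1.
have mk x : measurable_fun setT (fun z : k.-tuple R => (tkernel s p x z)%:E).
  by apply/measurable_EFinP; exact: measurable_tkernel.
have i0 x : (0 <= \1_I x :> R)%R by rewrite indicE ler0n.
(* [C] comes without a sign, hence the absolute value. *)
apply: (@le_lt_trans _ _ (\int[mu]_x ((\1_I x)%:E * `|C|%:E))).
  apply: ge0_le_integral => //.
  - by move=> x _; exact: integral_ge0.
  - exact: (@measurable_fun_fubini_tonelli_F _ _ _ _ _ mu _ m1k (fun w => ge0 w.1 w.1 w.2)).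
  - by apply: emeasurable_funM => //; apply/measurable_EFinP; exact: m1.
  move=> x _; under eq_integral do rewrite EFinM.
  rewrite ge0_integralZl_EFin//; last by move=> z _; rewrite lee_fin tkernel_ge0.
  apply: lee_pmul => //.
    by apply: integral_ge0 => z _; rewrite lee_fin tkernel_ge0.
  by rewrite (le_trans (HC x))// lee_fin ler_norm.
rewrite ge0_integralZr//.
- by rewrite integral_indic// setIT muleC lte_mul_pinfty.
- by apply/measurable_EFinP; exact: m1.
Qed.

(** The weight counts pairs with at least one end in [I]. Tonelli and the symmetry of the kernel
    reduce the second indicator to the first. *)
Lemma cross_kernel_lty :
  \int[mu]_x \int[mu]_z ((\1_I x + \1_I z) * tkernel s p x z)%:E < +oo.
Proof.
under eq_integral => x _.
  under eq_integral do rewrite mulrDl EFinD.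
  rewrite ge0_integralD//; last 2 first.
    exact: (measurable_fun_pair2 _ m1k).
    exact: (measurable_fun_pair2 _ m2k).
  over.
rewrite ge0_integralD//.
- apply: lte_add_pinfty; first exact: left_kernel_lty.
  rewrite (@fubini_tonelli _ _ _ _ _ mu mu _ m2k)//.
  under eq_integral do under eq_integral do rewrite tkernelC.
  exact: left_kernel_lty.
- by move=> x _; exact: integral_ge0.
- exact: (@measurable_fun_fubini_tonelli_F _ _ _ _ _ mu _ m1k (fun w => ge0 w.1 w.1 w.2)).
- by move=> x _; exact: integral_ge0.
- exact: (@measurable_fun_fubini_tonelli_F _ _ _ _ _ mu _ m2k (fun w => ge0 w.2 w.1 w.2)).
Qed.

End one_block.


Section separate.
Context d1 d2 (T1 : measurableType d1) (T2 : measurableType d2).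
Variables (m1 : {sigma_finite_measure set T1 -> \bar R})
          (m2 : {sigma_finite_measure set T2 -> \bar R}).

Lemma integral_sfprod_indic_snd (H : T1 -> \bar R) (J : set T2) :
  measurable_fun setT H -> (forall x, 0 <= H x) -> measurable J ->
  \int[sfprod m1 m2]_q ((\1_J q.2)%:E * H q.1) = m2 J * \int[m1]_x H x.
Proof.
move=> mH H0 mJ.
have mJ1 : measurable_fun setT (fun y => (\1_J y : R)%:E).
  by apply/measurable_EFinP; exact: measurable_indic.
have J0 y : 0 <= (\1_J y : R)%:E by rewrite lee_fin indicE ler0n.
rewrite fubini_tonelli1; last 2 first.
- apply: emeasurable_funM; first exact: (measurableT_comp mJ1).
  exact: (measurableT_comp mH).
- by move=> q; rewrite mule_ge0.
rewrite /fubini_F/=; under eq_integral => x _.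
  rewrite ge0_integralZr// integral_indic// setIT; over.
by rewrite ge0_integralZl.
Qed.

Lemma integral_sfprod_indic_fst (H : T2 -> \bar R) (I : set T1) :
  measurable_fun setT H -> (forall y, 0 <= H y) -> measurable I ->
  \int[sfprod m1 m2]_q ((\1_I q.1)%:E * H q.2) = m1 I * \int[m2]_y H y.
Proof.
move=> mH H0 mI.
have mI1 : measurable_fun setT (fun x => (\1_I x : R)%:E).
  by apply/measurable_EFinP; exact: measurable_indic.
have I0 x : 0 <= (\1_I x : R)%:E by rewrite lee_fin indicE ler0n.
rewrite fubini_tonelli2; last 2 first.
- apply: emeasurable_funM; first exact: (measurableT_comp mI1).
  exact: (measurableT_comp mH).
- by move=> q; rewrite mule_ge0.
rewrite /fubini_G/=; under eq_integral => y _.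
  rewrite ge0_integralZr// integral_indic// setIT; over.
by rewrite ge0_integralZl.
Qed.

End separate.

Variables (n m : nat).
Local Notation T := (n.-tuple R * m.-tuple R)%type.

Definition sub_fst (w : (T * n.-tuple R)%type) : T := (w.2, w.1.2).
Definition sub_snd (w : (T * m.-tuple R)%type) : T := (w.1.1, w.2).

Lemma measurable_sub_fst : measurable_fun setT sub_fst.
Proof.
apply: measurable_fun_pair => //.
exact: (measurableT_comp measurable_snd measurable_fst).
Qed.

Lemma measurable_sub_snd : measurable_fun setT sub_snd.
Proof.
apply: measurable_fun_pair => //.
exact: (measurableT_comp measurable_fst measurable_fst).
Qed.

Section direction.
Variables (k : nat) (pr : T -> k.-tuple R) (sub : (T * k.-tuple R)%type -> T).
Hypotheses (mpr : measurable_fun setT pr) (msub : measurable_fun setT sub).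
Variables (eta A : T -> R) (I : set (k.-tuple R)).
Hypotheses (meta : measurable_fun setT eta) (mA : measurable_fun setT A).
Hypotheses (A0 : forall q, (0 <= A q)%R) (mI : measurable I).

Let H (x : k.-tuple R) :=
  \int[tmeas R k]_z ((\1_I x + \1_I z) * tkernel s p x z)%:E.

Let m1 d (S : measurableType d) (f : S -> k.-tuple R) : measurable_fun setT f ->
  measurable_fun setT (fun w => \1_I (f w) : R).
Proof.
by move=> mf; apply: (measurableT_comp _ mf); exact: measurable_indic.
Qed.

Let ge0 (x z : k.-tuple R) : 0 <= ((\1_I x + \1_I z) * tkernel s p x z)%:E.
Proof. by rewrite lee_fin mulr_ge0 ?tkernel_ge0// !indicE addr_ge0 ?ler0n. Qed.

Let mHk d (S : measurableType d) (f g : S -> k.-tuple R) :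
  measurable_fun setT f -> measurable_fun setT g -> measurable_fun setT
  (fun w => ((\1_I (f w) + \1_I (g w)) * tkernel s p (f w) (g w))%:E).
Proof.
move=> mf mg; apply/measurable_EFinP; apply: measurable_funM.
  by apply: measurable_funD; exact: m1.
exact: measurable_tkernel.
Qed.

Lemma cross_kernel_ge0 x : 0 <= H x.
Proof. exact: integral_ge0. Qed.

Lemma measurable_cross_kernel : measurable_fun setT H.
Proof.
exact: (@measurable_fun_fubini_tonelli_F _ _ _ _ _ (tmeas R k) _
  (mHk measurable_fst measurable_snd) (fun w => ge0 w.1 w.2)).
Qed.

(** [A] records that the block left fixed lies in its cube, and [I] is the cube of the moved block.
    A pair contributes only if [eta] is nonzero at one end, and then the weight is at least 1. *)
Lemma energy_le_cross_kernel :
  (forall w, `|eta w.1 - eta (sub w)| <= Num.min 1 (tdist (pr w.1) w.2))%R ->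
  (forall w, eta w.1 != 0 \/ eta (sub w) != 0 ->
     A w.1 = 1 /\ (I (pr w.1) \/ I w.2))%R ->
  energy pr sub (k%:R + s * p) p eta <= \int[mupt R n m]_q ((A q)%:E * H (pr q)).
Proof.
move=> Hlip Hsupp.
have p0 : (0 < p)%R by exact: lt_trans ltr01 p1.
pose G (w : (T * k.-tuple R)%type) : \bar R :=
  (A w.1)%:E * ((\1_I (pr w.1) + \1_I w.2) * tkernel s p (pr w.1) w.2)%:E.
have mG : measurable_fun setT G.
  apply: emeasurable_funM.
    by apply/measurable_EFinP; exact: (measurableT_comp mA).
  by apply: mHk => //; exact: (measurableT_comp mpr).
have G0 w : 0 <= G w by rewrite mule_ge0// lee_fin.
have -> : \int[mupt R n m]_q ((A q)%:E * H (pr q)) = \int[muw R n m k]_w G w.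
  rewrite [RHS]fubini_tonelli1// /fubini_F; apply: eq_integral => q _.
  rewrite /G/= ge0_integralZl_EFin//.
  exact: (mHk (measurable_cst _) (@measurable_id _ _ _)).
apply: ge0_le_integral => //.
- by move=> w _; rewrite lee_fin divr_ge0 ?powR_ge0.
- by apply: measurable_integrand => //; exact: measurable_energy.
move=> w _; rewrite /G -EFinM lee_fin /tkernel mulrA mulrA.
rewrite ler_wpM2r ?invr_ge0 ?powR_ge0//.
have I0 (x : k.-tuple R) : (0 <= \1_I x :> R)%R by rewrite indicE ler0n.
have [->|dn0] := eqVneq (`|eta w.1 - eta (sub w)|)%R 0%R.
  by rewrite (powR0 (lt0r_neq0 p0)) !mulr_ge0 ?addr_ge0 ?powR_ge0.
have [|-> Ior] := Hsupp w.
  have [e1|] := eqVneq (eta w.1) 0%R; last by left.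
  have [e2|] := eqVneq (eta (sub w)) 0%R; last by right.
  by move: dn0; rewrite e1 e2 subrr normr0 eqxx.
rewrite mul1r; apply: (@le_trans _ _ (Num.min 1 (tdist (pr w.1) w.2) `^ p)%R).
  by apply: ge0_ler_powR; rewrite ?nnegrE ?(ltW p0)// le_min ler01 tdist_ge0.
rewrite ler_peMl ?powR_ge0//; case: Ior => /mem_set h.
  by rewrite [X in (_ <= X + _)%R]indicE h lerDl.
by rewrite [X in (_ <= _ + X)%R]indicE h lerDr.
Qed.

End direction.

(** A move of the first block keeps the second one, which must lie in [J] for the pair to count. The
    bounding integral therefore factors as the volume of [J] times [cross_kernel_lty]. *)
Lemma tent_energy_fst_lty (c : 'rV[R]_(n + m)) (r : R) : (0 < r <= 1)%R ->
  energy (@fst _ _) sub_fst (n%:R + s * p) p (tent c r) < +oo.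
Proof.
move=> r01; have r0 : (0 < r)%R by case/andP : r01.
set I := box (cfst c) r; set J := box (csnd c) r.
have mI : measurable I by exact: measurable_box.
have mJ : measurable J by exact: measurable_box.
have Bn0 (q : T) : (tent c r q != 0)%R -> I q.1 /\ J q.2.
  move=> h; have : (0 < tent c r q)%R by rewrite lt_neqAle eq_sym h tent_ge0.
  by rewrite tent_gt0 => /norm_vec_of_ltP; exact.
apply: (@le_lt_trans _ _ (\int[mupt R n m]_q ((\1_J q.2)%:E *
  \int[tmeas R n]_z ((\1_I q.1 + \1_I z) * tkernel s p q.1 z)%:E))).
  apply: (@energy_le_cross_kernel n _ _ measurable_fst measurable_sub_fst _
    (fun q => \1_J q.2) I) => //.
  - exact: measurable_tent.
  - by apply: (@measurableT_comp _ _ _ _ _ _ (\1_J : _ -> R) _ _ _ measurable_snd); exact: measurable_indic.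
  - move=> w; apply: tent_diff_le => //=; first exact: tdist_ge0.
      by move=> i; rewrite ?subrr ?normr0 ?tdist_ge0 ?tdist_coord.
    by move=> i; rewrite ?subrr ?normr0 ?tdist_ge0 ?tdist_coord.
  - move=> [[x y] z] [/Bn0[/= h1 h2]|/Bn0[/= h1 h2]]; rewrite indicE mem_set//; tauto.
rewrite (@integral_sfprod_indic_snd _ _ _ _ (tmeas R n) (tmeas R m) (fun x =>
  \int[tmeas R n]_z ((\1_I x + \1_I z) * tkernel s p x z)%:E))//.
- rewrite tmeas_box ?(ltW r0)// lte_mul_pinfty// ?lee_fin ?exprn_ge0 ?mulrn_wge0 ?(ltW r0)//.
  by apply: cross_kernel_lty => //; rewrite tmeas_box ?(ltW r0)// ltry.
- exact: measurable_cross_kernel.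
- by move=> x; exact: cross_kernel_ge0.
Qed.

Lemma tent_energy_snd_lty (c : 'rV[R]_(n + m)) (r : R) : (0 < r <= 1)%R ->
  energy (@snd _ _) sub_snd (m%:R + s * p) p (tent c r) < +oo.
Proof.
move=> r01; have r0 : (0 < r)%R by case/andP : r01.
set I := box (csnd c) r; set J := box (cfst c) r.
have mI : measurable I by exact: measurable_box.
have mJ : measurable J by exact: measurable_box.
have Bn0 (q : T) : (tent c r q != 0)%R -> J q.1 /\ I q.2.
  move=> h; have : (0 < tent c r q)%R by rewrite lt_neqAle eq_sym h tent_ge0.
  by rewrite tent_gt0 => /norm_vec_of_ltP; exact.
apply: (@le_lt_trans _ _ (\int[mupt R n m]_q ((\1_J q.1)%:E *
  \int[tmeas R m]_z ((\1_I q.2 + \1_I z) * tkernel s p q.2 z)%:E))).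
  apply: (@energy_le_cross_kernel m _ _ measurable_snd measurable_sub_snd _
    (fun q => \1_J q.1) I) => //.
  - exact: measurable_tent.
  - by apply: (@measurableT_comp _ _ _ _ _ _ (\1_J : _ -> R) _ _ _ measurable_fst); exact: measurable_indic.
  - move=> w; apply: tent_diff_le => //=; first exact: tdist_ge0.
      by move=> i; rewrite ?subrr ?normr0 ?tdist_ge0 ?tdist_coord.
    by move=> i; rewrite ?subrr ?normr0 ?tdist_ge0 ?tdist_coord.
  - move=> [[x y] z] [/Bn0[/= h1 h2]|/Bn0[/= h1 h2]]; rewrite indicE mem_set//; tauto.
rewrite (@integral_sfprod_indic_fst _ _ _ _ (tmeas R n) (tmeas R m) (fun x =>
  \int[tmeas R m]_z ((\1_I x + \1_I z) * tkernel s p x z)%:E))//.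
- rewrite tmeas_box ?(ltW r0)// lte_mul_pinfty// ?lee_fin ?exprn_ge0 ?mulrn_wge0 ?(ltW r0)//.
  by apply: cross_kernel_lty => //; rewrite tmeas_box ?(ltW r0)// ltry.
- exact: measurable_cross_kernel.
- by move=> x; exact: cross_kernel_ge0.
Qed.

End tent_energy.

(** * Minimality *)

Section variational.
Variables (R : realType) (n m : nat) (s p : R).
Hypotheses (s01 : 0 < s < 1) (p1 : 1 < p).
Local Open Scope ereal_scope.
Local Notation T := (n.-tuple R * m.-tuple R)%type.
Implicit Types (u v : T -> R) (Om : set 'rV[R]_(n + m)).

Let p0 : (0 < p)%R. Proof. exact: lt_trans ltr01 p1. Qed.
Let pn0 : p != 0%R. Proof. exact: lt0r_neq0. Qed.

Local Notation energy_fst := (energy (@fst (n.-tuple R) (m.-tuple R)) (@sub_fst R n m) (n%:R + s * p) p).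
Local Notation energy_snd := (energy (@snd (n.-tuple R) (m.-tuple R)) (@sub_snd R n m) (m%:R + s * p) p).

Lemma seminormE u : measurable_fun setT u -> seminorm s p u = energy_fst u + energy_snd u.
Proof.
move=> mu; congr (_ + _).
  apply: int_nm_iintE; last by move=> q z; rewrite lee_fin divr_ge0 ?powR_ge0.
  apply: (measurable_integrand measurable_fst).
  exact: (measurable_energy (@measurable_sub_fst R n m) p mu).
apply: int_nm_iintE; last by move=> q z; rewrite lee_fin divr_ge0 ?powR_ge0.
apply: (measurable_integrand measurable_snd).
exact: (measurable_energy (@measurable_sub_snd R n m) p mu).
Qed.

Lemma measurable_normpow u : measurable_fun setT u ->
  measurable_fun setT (fun q => (`|u q| `^ p)%:E).
Proof.
move=> mu; apply/measurable_EFinP; apply: measurable_fun_powR.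
exact: measurableT_comp.
Qed.

Lemma Lp_powE u : measurable_fun setT u ->
  Lp_pow p u = \int[mupt R n m]_q (`|u q| `^ p)%:E.
Proof.
move=> mu; apply: int_nmE; first exact: measurable_normpow.
by move=> q; rewrite lee_fin powR_ge0.
Qed.

Lemma indic_vanish Om u q : (forall q, ~ OmS Om q -> u q = 0%R) ->
  (\1_(OmS Om) q * u q = u q)%R.
Proof.
move=> u0; rewrite indicE; have [_|/negP h] := boolP (_ \in _); first by rewrite mul1r.
by rewrite mul0r u0// => h'; apply: h; rewrite inE.
Qed.

Lemma Lp_pow_onE Om u : (forall q, ~ OmS Om q -> u q = 0%R) ->
  Lp_pow_on p Om u = Lp_pow p u.
Proof.
move=> u0; congr int_nm; apply/funext => q; congr EFin.
by apply: (@indic_vanish Om (fun q => `|u q| `^ p)%R) => {}q /u0 ->; rewrite normr0 powR0.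
Qed.

Lemma ppowM (a : R) : (ppow p a * a = `|a| `^ p)%R.
Proof.
rewrite /ppow -mulrA; have [->|a0] := eqVneq a 0%R.
  by rewrite mulr0 mulr0 normr0 powR0.
rewrite -expr2 -real_normK ?num_real// -powR_mulrn ?normr_ge0//.
by rewrite -powRD ?normr_eq0 ?a0 ?implybT// subrK.
Qed.

Lemma int_nm_iint0 k : int_nm (fun _ : T => iint (fun _ : k.-tuple R => 0)) = 0.
Proof.
rewrite (@int_nm_iintE R n m k (fun _ _ => 0))//.
by rewrite integral0.
Qed.

Lemma sint_nm_ge0 (F : T -> R) : (forall q, 0 <= F q)%R ->
  sint_nm F = fine (int_nm (fun q => (F q)%:E)).
Proof.
move=> F0; rewrite /sint_nm.
have -> : (fun q => (Num.max (F q) 0)%:E) = (fun q => (F q)%:E).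
  by apply/funext => q; rewrite max_l.
have -> : (fun q => (Num.max (- F q) 0)%:E) = (fun=> 0).
  by apply/funext => q; rewrite max_r// oppr_le0.
rewrite [X in (_ - fine X)%R]int_nmE//.
by rewrite integral0 subr0.
Qed.

Lemma sint_iint_ge0 k (G : T -> k.-tuple R -> R) : (forall q z, 0 <= G q z)%R ->
  (fine (int_nm (fun q => iint (fun z => (Num.max (G q z) 0)%:E))) -
   fine (int_nm (fun q => iint (fun z => (Num.max (- G q z) 0)%:E))))%R =
  fine (int_nm (fun q => iint (fun z => (G q z)%:E))).
Proof.
move=> G0.
have -> : (fun q => iint (fun z => (Num.max (G q z) 0)%:E)) =
    (fun q => iint (fun z => (G q z)%:E)).
  by apply/funext => q; congr iint; apply/funext => z; rewrite max_l.
have -> : (fun q => iint (fun z => (Num.max (- G q z) 0)%:E)) =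
    (fun q => iint (fun z : k.-tuple R => 0)).
  by apply/funext => q; congr iint; apply/funext => z; rewrite max_r// oppr_le0.
by rewrite int_nm_iint0 subr0.
Qed.

Lemma energy_lty u : measurable_fun setT u -> seminorm s p u < +oo ->
  energy_fst u < +oo /\ energy_snd u < +oo.
Proof.
move=> mu; rewrite seminormE// => uoo; split; apply: le_lt_trans uoo.
  by rewrite leeDl// energy_ge0.
by rewrite leeDr// energy_ge0.
Qed.

(** By [ppowM] the integrand is the energy density, so its negative part is zero. Finite energy is
    used because [fine] is additive only on finite values. *)
Lemma Hsp_diag u : measurable_fun setT u -> seminorm s p u < +oo ->
  Hsp s p u u = fine (seminorm s p u).
Proof.
move=> mu uoo.
have [foo soo] := energy_lty mu uoo.
have Df : energy_fst u \is a fin_num by rewrite ge0_fin_numE ?energy_ge0.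
have Ds : energy_snd u \is a fin_num by rewrite ge0_fin_numE ?energy_ge0.
rewrite [in RHS]seminormE// fineD//; congr (_ + _)%R.
  rewrite /sint_nm_n /int_nm_n sint_iint_ge0; last first.
    by move=> q z; rewrite ppowM divr_ge0 ?powR_ge0.
  under eq_fun do under eq_fun do rewrite ppowM.
  congr fine; apply: (@int_nm_iintE R n m n (fun q z =>
     (`|u q - u (z, q.2)| `^ p / tdist q.1 z `^ (n%:R + s * p))%:E)).
    apply: (measurable_integrand measurable_fst).
    exact: (measurable_energy (@measurable_sub_fst R n m) p mu).
  by move=> q z; rewrite lee_fin divr_ge0 ?powR_ge0.
rewrite /sint_nm_m /int_nm_m sint_iint_ge0; last first.
  by move=> q z; rewrite ppowM divr_ge0 ?powR_ge0.
under eq_fun do under eq_fun do rewrite ppowM.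
congr fine; apply: (@int_nm_iintE R n m m (fun q z =>
   (`|u q - u (q.1, z)| `^ p / tdist q.2 z `^ (m%:R + s * p))%:E)).
  apply: (measurable_integrand measurable_snd).
  exact: (measurable_energy (@measurable_sub_snd R n m) p mu).
by move=> q z; rewrite lee_fin divr_ge0 ?powR_ge0.
Qed.

(** Tests the eigenvalue equation with [u] itself. *)
Lemma eigenpair_energy Om lambda u : eigenpair s p Om lambda u ->
  fine (seminorm s p u) = (lambda * fine (Lp_pow p u))%R.
Proof.
move=> [Wu [_ Eu]]; have [mu [_ [uoo u0]]] := Wu.
rewrite -Hsp_diag// Eu//; congr (_ * _)%R.
have H q : (\1_(OmS Om) q * ppow p (u q) * u q = `|u q| `^ p)%R.
  by rewrite -mulrA mulrCA indic_vanish// ppowM.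
rewrite sint_nm_ge0; last by move=> q; rewrite H powR_ge0.
by congr fine; congr int_nm; apply/funext => q; rewrite H.
Qed.

Lemma lambda1_le Om lambda v : lambda%:E = lambda1 s p Om ->
  Wtilde s p Om v -> ~ ae_zero v ->
  (lambda * fine (Lp_pow p v) <= fine (seminorm s p v))%R.
Proof.
move=> lE Wv v0; have [mv [_ [voo vO]]] := Wv.
have Nge0 : (0 <= fine (Lp_pow p v))%R.
  by rewrite Lp_powE// fine_ge0// integral_ge0// => q _; rewrite lee_fin powR_ge0.
have Sge0 : (0 <= fine (seminorm s p v))%R.
  by rewrite seminormE// fine_ge0// adde_ge0 ?energy_ge0.
(* A quotient with zero denominator takes the default value 0 and says nothing about the energy; in
   that case nonnegativity suffices. *)
have [->|Nn0] := eqVneq (fine (Lp_pow p v)) 0%R; first by rewrite mulr0.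
rewrite -ler_pdivlMr; last by rewrite lt_neqAle eq_sym Nn0.
rewrite -lee_fin lE -(Lp_pow_onE vO); apply: ereal_inf_lbound.
by exists v.
Qed.

Lemma lambda1_ge0 Om lambda : lambda%:E = lambda1 s p Om -> (0 <= lambda)%R.
Proof.
move=> lE; rewrite -lee_fin lE; apply: le_ereal_inf_tmp => _ [v [Wv _] <-].
have [mv [_ [voo vO]]] := Wv.
rewrite lee_fin divr_ge0// fine_ge0//.
  by rewrite seminormE// adde_ge0 ?energy_ge0.
by rewrite Lp_pow_onE// Lp_powE// integral_ge0// => q _; rewrite lee_fin powR_ge0.
Qed.

End variational.

Lemma lee_add_scaled (R : realType) (k l : R) (x y x' y' A B A' B' : \bar R) :
  (0 <= A -> 0 <= B -> 0 <= A' -> 0 <= B' ->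
  x + k%:E * A <= x' + l%:E * A' -> y + k%:E * B <= y' + l%:E * B' ->
  (x + y) + k%:E * (A + B) <= (x' + y') + l%:E * (A' + B'))%E.
Proof.
move=> A0 B0 A'0 B'0 h1 h2.
by rewrite !ge0_muleDr// addeACA [leRHS]addeACA leeD.
Qed.

Lemma le_powR_vanish (R : realType) (a b h r : R) :
  0 < h -> 0 < r -> 0 <= b ->
  (forall e, 0 < e -> e <= h -> a <= e `^ r * b) -> a <= 0.
Proof.
move=> h0 r0 b0 H; rewrite leNgt; apply/negP => a0.
(* Chosen so that [x * b < a]; the [e] below then satisfies [e ^ r <= x], contradicting the
   hypothesis. *)
pose x := a / (2 * (b + 1)).
have x0 : 0 < x by rewrite divr_gt0// mulr_gt0// ltr_wpDl.
pose e := Num.min h (x `^ r^-1).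
have e0 : 0 < e by rewrite lt_min h0 powR_gt0.
have ex : e `^ r <= x.
  rewrite -[leRHS]powRr1 ?(ltW x0)// -(mulVf (lt0r_neq0 r0)) powRrM.
  by apply: ge0_ler_powR; rewrite ?nnegrE ?powR_ge0 ?(ltW r0) ?(ltW e0)// ge_min lexx orbT.
have := H e e0; rewrite ge_min lexx => /(_ isT).
apply/negP; rewrite -ltNge; apply: (@le_lt_trans _ _ (x * b)); first exact: ler_wpM2r.
rewrite /x mulrAC ltr_pdivrMr; last by lra.
by rewrite ltr_pM2l//; lra.
Qed.

(** * From vanishing cross energy to null sets of jumps *)

Section null_gain.
Variables (R : realType) (n m k : nat).
Local Notation T := (n.-tuple R * m.-tuple R)%type.
Variables (pr : T -> k.-tuple R) (sub : (T * k.-tuple R)%type -> T).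
Hypotheses (mpr : measurable_fun setT pr) (msub : measurable_fun setT sub).
Variables (a : R) (u eta : T -> R).
Hypotheses (mu : measurable_fun setT u) (meta : measurable_fun setT eta).
Hypothesis dist_gt0 : forall w, u w.1 = 0 -> u (sub w) != 0 -> 0 < tdist (pr w.1) w.2.

(** A nonnegative integrand with zero integral vanishes almost everywhere, while on the gain set the
    kernel is positive. [dist_gt0] excludes distance 0, where the inverse would be 0 by
    convention. *)
Lemma gain_set_negligible h : 0 < h -> cross_energy pr sub a u eta h = 0%E ->
  (muw R n m k).-negligible (gain_set sub u eta h).
Proof.
move=> h0 J0.
pose f (w : (T * k.-tuple R)%type) : \bar R :=
  (\1_(gain_set sub u eta h) w / tdist (pr w.1) w.2 `^ a)%:E.
have mf : measurable_fun setT f.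
  apply: measurable_integrand => //; apply: measurable_indic.
  exact: measurable_gain_set.
have : ae_eq (muw R n m k) setT f (cst 0%E).
  apply/ae_eq_integral_abs => //; rewrite -[RHS]J0; apply: eq_integral => w _.
  by rewrite gee0_abs// lee_fin divr_ge0 ?powR_ge0// indicE ler0n.
apply: negligibleS => w [/= u0 [etah uh]] /(_ I) /=.
rewrite /f indicE mem_set// mul1r => -[] /eqP.
rewrite invr_eq0 gt_eqF// powR_gt0// dist_gt0//.
by rewrite -normr_gt0 (lt_le_trans h0).
Qed.

Definition jump_set : set (T * k.-tuple R)%type :=
  [set w | u w.1 = 0 /\ 0 < eta w.1 /\ u (sub w) != 0].

(** Exhausts the jump set by the gain sets at the heights [1 / (j + 1)]. *)
Lemma jump_set_negligible :
  (forall h, 0 < h -> cross_energy pr sub a u eta h = 0%E) ->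
  measurable jump_set /\ muw R n m k jump_set = 0%E.
Proof.
move=> J0.
have -> : jump_set = \bigcup_j gain_set sub u eta j.+1%:R^-1.
  apply/seteqP; split => [w [uw [ew usw]]|w [j _ [uw [ew usw]]]]; last first.
    have j0 : (0 : R) < j.+1%:R^-1 by rewrite invr_gt0.
    split => //; split; first exact: lt_le_trans ew.
    by rewrite -normr_gt0; exact: lt_le_trans usw.
  have x0 : 0 < Num.min (eta w.1) `|u (sub w)| by rewrite lt_min ew normr_gt0.
  have [j _ hj] := near_infty_natSinv_lt (PosNum x0).
  exists j => //; have := hj j (leqnn j); rewrite /= lt_min => /andP[h1 h2].
  by split => //; split; exact: ltW.
have mg j : measurable (gain_set sub u eta j.+1%:R^-1) by exact: measurable_gain_set.
split; first exact: bigcupT_measurable.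
apply: measure_negligible; first exact: bigcupT_measurable.
apply: negligible_bigcup => j; apply: gain_set_negligible; first by rewrite invr_gt0.
by apply: J0; rewrite invr_gt0.
Qed.

End null_gain.

Section minimality.
Variables (R : realType) (n m : nat) (s p : R).
Hypotheses (s01 : 0 < s < 1) (p1 : 1 < p).
Local Open Scope ereal_scope.
Local Notation T := (n.-tuple R * m.-tuple R)%type.
Variables (Om : set 'rV[R]_(n + m)) (lambda : R) (u : T -> R).
Hypotheses (Eu : eigenpair s p Om lambda u) (lE : lambda%:E = lambda1 s p Om).
Variables (c : 'rV[R]_(n + m)) (r : R).
Hypotheses (r01 : (0 < r <= 1)%R).
Hypothesis ball_sub : forall q : T, (`|vec_of q - c| < r)%R -> OmS Om q.

Local Notation energy_fst := (energy (@fst (n.-tuple R) (m.-tuple R)) (@sub_fst R n m) (n%:R + s * p) p).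
Local Notation energy_snd := (energy (@snd (n.-tuple R) (m.-tuple R)) (@sub_snd R n m) (m%:R + s * p) p).
Local Notation cross_fst := (cross_energy (@fst (n.-tuple R) (m.-tuple R)) (@sub_fst R n m) (n%:R + s * p)).
Local Notation cross_snd := (cross_energy (@snd (n.-tuple R) (m.-tuple R)) (@sub_snd R n m) (m%:R + s * p)).
Local Notation eta := (tent c r : T -> R).

Let p0 : (0 < p)%R. Proof. exact: lt_trans ltr01 p1. Qed.
Let r0 : (0 < r)%R. Proof. by case/andP : r01. Qed.
Let r1 : (r <= 1)%R. Proof. by case/andP : r01. Qed.
Let mu : measurable_fun setT u. Proof. by case: Eu => -[]. Qed.
Let meta : measurable_fun setT eta. Proof. exact: measurable_tent. Qed.

Section competitor.
Variables (e h : R).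
Hypotheses (e0 : (0 < e)%R) (h0 : (0 < h)%R) (eh : (e <= h)%R).

Let eeta q : (e * eta q <= h)%R.
Proof.
rewrite (le_trans _ eh)// ler_piMr ?(ltW e0)//.
exact: le_trans (tent_le _ _ r0) r1.
Qed.

Let M : T -> R := (fun q => Num.max `|u q| (e * eta q))%R.

Let gain_fst : energy_fst M + (e * h `^ p)%:E * cross_fst u eta h <=
  energy_fst u + (e `^ p)%:E * energy_fst eta.
Proof.
apply: (energy_max_gain measurable_fst (@measurable_sub_fst R n m) _ p1) => //.
by move=> q; exact: tent_ge0.
Qed.

Let gain_snd : energy_snd M + (e * h `^ p)%:E * cross_snd u eta h <=
  energy_snd u + (e `^ p)%:E * energy_snd eta.
Proof.
apply: (energy_max_gain measurable_snd (@measurable_sub_snd R n m) _ p1) => //.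
by move=> q; exact: tent_ge0.
Qed.

Let mM : measurable_fun setT M.
Proof.
apply: measurable_maxr; first by apply: measurableT_comp.
exact: measurable_funM.
Qed.

Let uM q : (`|u q| <= M q)%R. Proof. by rewrite le_max lexx. Qed.
Let M0 q : (0 <= M q)%R. Proof. exact: le_trans (uM q). Qed.

Let total_gain : seminorm s p M +
    (e * h `^ p)%:E * (cross_fst u eta h + cross_snd u eta h) <=
  seminorm s p u + (e `^ p)%:E * seminorm s p eta.
Proof.
rewrite !seminormE//; apply: lee_add_scaled gain_fst gain_snd; rewrite ?energy_ge0 ?cross_energy_ge0//.
Qed.

Lemma seminorm_tent_lty : seminorm s p eta < +oo.
Proof.
by rewrite seminormE// lte_add_pinfty ?tent_energy_fst_lty ?tent_energy_snd_lty.
Qed.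

Let seminorm_M_lty : seminorm s p M < +oo.
Proof.
apply: le_lt_trans (_ : seminorm s p u + (e `^ p)%:E * seminorm s p eta < +oo).
  apply: le_trans total_gain; rewrite leeDl// mule_ge0 ?lee_fin ?mulr_ge0 ?powR_ge0 ?(ltW e0)//.
  by rewrite adde_ge0 ?cross_energy_ge0.
apply: lte_add_pinfty; first by case: Eu => -[_ [_ []]].
by rewrite lte_mul_pinfty ?lee_fin ?powR_ge0// seminorm_tent_lty.
Qed.

Let Lp_M_lty : Lp_pow p M < +oo.
Proof.
set I := box (cfst c) r; set J := box (csnd c) r.
have mI : measurable I by exact: measurable_box.
have mJ : measurable J by exact: measurable_box.
have m1 : measurable_fun setT (fun q : T => (\1_(I `*` J) q : R)%:E).
  by apply/measurable_EFinP; apply: measurable_indic; exact: measurableX.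
rewrite Lp_powE//.
apply: (@le_lt_trans _ _ (\int[mupt R n m]_q ((`|u q| `^ p)%:E +
    (e `^ p)%:E * (\1_(I `*` J) q)%:E))).
  apply: ge0_le_integral => //.
  - exact: measurable_normpow.
  - apply: emeasurable_funD; first exact: measurable_normpow.
    exact: emeasurable_funM.
  move=> q _; rewrite -EFinM -EFinD lee_fin ger0_norm//.
  (* Where the tent wins, the point lies in the ball and the value is at most [e], since the tent
     has height at most [r <= 1]. *)
  rewrite /M; have [_|h1] := leP (e * eta q)%R `|u q|%R.
    by rewrite lerDl mulr_ge0 ?powR_ge0// indicE ler0n.
  have eta0 : (0 < eta q)%R.
    by rewrite -(pmulr_rgt0 _ e0); exact: le_lt_trans h1.
  have : (`|vec_of q - c| < r)%R by rewrite -tent_gt0.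
  move=> /(norm_vec_of_ltP c q r0) IJ.
  rewrite indicE mem_set ?mulr1; last exact: IJ.
  rewrite ler_wpDl ?powR_ge0//; apply: ge0_ler_powR; rewrite ?nnegrE ?(ltW p0) ?(ltW e0)//.
    by rewrite mulr_ge0 ?(ltW e0) ?(ltW eta0).
  by rewrite ler_piMr ?(ltW e0)// (le_trans (tent_le _ _ r0) r1).
rewrite ge0_integralD//.
- apply: lte_add_pinfty.
    by rewrite -Lp_powE//; case: Eu => -[_ []].
  rewrite ge0_integralZl_EFin ?powR_ge0// integral_indic ?setIT//; last exact: measurableX.
  rewrite lte_mul_pinfty ?lee_fin ?powR_ge0//.
  rewrite [ltLHS](_ : _ = tmeas R n I * tmeas R m J); last exact: product_measure1E.
  by rewrite !tmeas_box ?(ltW r0)// -EFinM ltry.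
- exact: measurable_normpow.
- by move=> q _; rewrite mule_ge0 ?lee_fin ?powR_ge0// indicE ler0n.
- exact: emeasurable_funM.
Qed.

Let W_M : Wtilde s p Om M.
Proof.
split => //; split => //; split => // q nq.
have -> : M q = Num.max `|u q|%R (e * eta q)%R by [].
case: Eu => -[_ [_ [_ ->]]] // _; rewrite normr0.
have -> : eta q = 0%R; last by rewrite mulr0 maxxx.
apply/eqP; rewrite eq_le tent_ge0 andbT leNgt tent_gt0.
by apply/negP => /ball_sub.
Qed.

Let M_neq0 : ~ ae_zero M.
Proof.
case: Eu => _ [u0 _] MZ; apply: u0.
have mne (f : T -> R) : measurable_fun setT f -> measurable [set q | f q != 0%R].
  move=> mf; rewrite (_ : mkset _ = ~` [set q | f q = 0%R]).
    exact/measurableC/measurable_set_eq0.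
  by apply/seteqP; split => q /= /eqP.
move: MZ; rewrite /ae_zero !leb_nmE; [|exact: mne|exact: mne].
move=> MZ; apply/eqP; rewrite eq_le measure_ge0 andbT -MZ.
apply: le_measure; rewrite ?inE; [exact: mne|exact: mne|].
move=> q /= uq; have : (0 < M q)%R by apply: lt_le_trans (uM q); rewrite normr_gt0.
by move=> /lt0r_neq0.
Qed.

(** As [|u| <= M] and [lambda >= 0], the energy of [M] is at least [lambda] times the norm power of
    [M], hence at least that of [u], which equals the energy of [u]. The finite energy of [u] then
    cancels in [total_gain]. *)
Lemma cross_energy_le :
  (e * h `^ p)%:E * (cross_fst u eta h + cross_snd u eta h) <=
  (e `^ p)%:E * seminorm s p eta.
Proof.
have [_ [_ [uoo _]]] : Wtilde s p Om u by case: Eu.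
have uM' : seminorm s p u <= seminorm s p M.
  have fu : seminorm s p u \is a fin_num.
    by rewrite ge0_fin_numE// seminormE// adde_ge0 ?energy_ge0.
  have fM : seminorm s p M \is a fin_num.
    by rewrite ge0_fin_numE// seminormE// adde_ge0 ?energy_ge0.
  rewrite -(fineK fu) -(fineK fM) lee_fin (eigenpair_energy p1 Eu).
  apply: le_trans (lambda1_le p1 lE W_M M_neq0).
  apply: ler_wpM2l; first exact: (lambda1_ge0 p1 lE).
  have [_ [Lu _]] : Wtilde s p Om u by case: Eu.
  have ge0 (f : T -> R) : measurable_fun setT f -> 0 <= Lp_pow p f.
    by move=> mf; rewrite Lp_powE//; apply: integral_ge0 => q _; rewrite lee_fin powR_ge0.
  apply: fine_le; rewrite ?ge0_fin_numE ?ge0//.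
  rewrite !Lp_powE//; apply: ge0_le_integral => //.
  - exact: measurable_normpow.
  - exact: measurable_normpow.
  move=> q _; rewrite lee_fin; apply: ge0_ler_powR; rewrite ?nnegrE ?(ltW p0)//.
  by rewrite [leRHS]ger0_norm.
have fu : seminorm s p u \is a fin_num.
  by rewrite ge0_fin_numE// seminormE// adde_ge0 ?energy_ge0.
rewrite -(@leeD2lE _ (seminorm s p u))//.
by apply: le_trans total_gain; rewrite leeD2r.
Qed.

End competitor.

(** Dividing [cross_energy_le] by [e] leaves [e ^ (p - 1)] on the right, which tends to 0 with
    [e]. *)
Lemma cross_energy_eq0 (h : R) : (0 < h)%R ->
  cross_fst u eta h = 0 /\ cross_snd u eta h = 0.
Proof.
move=> h0; set Jf := cross_fst u eta h; set Js := cross_snd u eta h.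
have Jf0 : 0 <= Jf by exact: cross_energy_ge0.
have Js0 : 0 <= Js by exact: cross_energy_ge0.
have H e : (0 < e)%R -> (e <= h)%R ->
    (e * h `^ p)%:E * (Jf + Js) <= (e `^ p)%:E * seminorm s p eta.
  by move=> e0 eh; exact: cross_energy_le.
have S0 : 0 <= seminorm s p eta by rewrite seminormE// adde_ge0 ?energy_ge0.
have Sfin : seminorm s p eta \is a fin_num by rewrite ge0_fin_numE// seminorm_tent_lty.
suff : Jf + Js = 0 by move/eqP; rewrite padde_eq0// => /andP[/eqP-> /eqP->].
have J0 : 0 <= Jf + Js by rewrite adde_ge0.
clearbody Jf Js; move: S0 Sfin J0 H; case: (seminorm s p eta) => // sg; rewrite lee_fin => S0 _.
(* An infinite cross energy is excluded by taking [e = h], since the right-hand side is finite. *)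
case: (Jf + Js) => // [j|] J0 H; last first.
  have hp0 : 0 < (h * h `^ p)%:E by rewrite lte_fin mulr_gt0 ?powR_gt0.
  by have := H h h0 (lexx h); rewrite (gt0_muley hp0) -EFinM.
congr EFin; apply/eqP; rewrite eq_le -[X in _ && X]lee_fin J0 andbT.
rewrite -(pmulr_rle0 _ (powR_gt0 p h0)).
apply: (@le_powR_vanish _ _ sg h (p - 1)) => //; first by rewrite subr_gt0.
move=> e e0 eh; have := H e e0 eh; rewrite -!EFinM lee_fin.
by rewrite -mulrA -(mulr_powRB1 (ltW e0) p0) -mulrA ler_pM2l.
Qed.


End minimality.

Lemma tdist_gt0 (R : realType) k (x z : k.-tuple R) : x <> z -> 0 < tdist x z.
Proof.
move=> xz; rewrite lt_neqAle tdist_ge0 andbT eq_sym; apply/eqP => d0; apply: xz.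
apply: eq_from_tnth => i; apply/eqP; rewrite -subr_eq0 -normr_le0 -d0.
exact: tdist_coord.
Qed.

Lemma sfprod_setX d1 d2 (T1 : measurableType d1) (T2 : measurableType d2)
    (R : realType) (m1 : {sigma_finite_measure set T1 -> \bar R})
    (m2 : {sigma_finite_measure set T2 -> \bar R}) A B :
  measurable A -> measurable B -> sfprod m1 m2 (A `*` B) = (m1 A * m2 B)%E.
Proof. exact: product_measure1E. Qed.

(** * Null sets and connectedness *)

Section null_products.
Local Open Scope ereal_scope.
Context d1 d2 d3 d4 (T1 : measurableType d1) (T2 : measurableType d2)
  (T3 : measurableType d3) (T4 : measurableType d4) (R : realType).
Variables (m1 : {sigma_finite_measure set T1 -> \bar R})
          (m2 : {sigma_finite_measure set T2 -> \bar R})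
          (m3 : {sigma_finite_measure set T3 -> \bar R})
          (m4 : {sigma_finite_measure set T4 -> \bar R}).

(** Each section is a product with the whole third space, so its possibly infinite mass factors out
    of an integral that is zero, and [0 * +oo = 0]. *)
Lemma null_product_left (E : set (T1 * T2)) : measurable E ->
  sfprod m1 m2 E = 0 ->
  sfprod m1 (sfprod m2 m3) [set w | E (w.1, w.2.1)] = 0.
Proof.
move=> mE E0; rewrite /sfprod/= /product_measure1.
have S x : xsection [set w : (T1 * (T2 * T3))%type | E (w.1, w.2.1)] x =
    xsection E x `*` setT.
  by rewrite !xsectionE; apply/seteqP; split => [[y z]|[y z] []].
under eq_integral => x _.
  rewrite /= S sfprod_setX//; last exact: measurable_xsection.
  over.
rewrite ge0_integralZr//.
  rewrite [X in X * _ = _](_ : _ = 0) ?mul0e//.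
exact: measurable_fun_xsection.
Qed.

(** For a fixed first pair the measure of the section depends only on its second component. By
    Tonelli the total is the mass of [m1] times the measure of [E], again with [+oo * 0 = 0]. *)
Lemma null_product_mid (E : set ((T3 * T2) * T4)) : measurable E ->
  sfprod (sfprod m3 m2) m4 E = 0 ->
  sfprod (sfprod m1 m2) (sfprod m3 m4) [set w | E ((w.2.1, w.1.2), w.2.2)] = 0.
Proof.
move=> mE E0.
pose phi (z : (T3 * T2)%type) := m4 (xsection E z).
have mphi : measurable_fun setT phi by exact: measurable_fun_xsection.
have phi0 z : 0 <= phi z by exact: measure_ge0.
pose psi (y : T2) := \int[m3]_x phi (x, y).
have psi0 y : 0 <= psi y by apply: integral_ge0.
have mpsi : measurable_fun setT psi.
  exact: (@measurable_fun_fubini_tonelli_G _ _ _ _ _ m3 _ mphi phi0).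
have S q : xsection [set w : ((T1 * T2) * (T3 * T4))%type |
    E ((w.2.1, w.1.2), w.2.2)] q = [set w | E ((w.1, q.2), w.2)].
  by rewrite xsectionE.
transitivity (\int[sfprod m1 m2]_q ((\1_(setT : set T1) q.1)%:E * psi q.2)).
  apply: eq_integral => q _; rewrite /= S indicE in_setT mul1e /psi.
  apply: eq_integral => x _; rewrite /phi /=; congr (m4 _).
rewrite integral_sfprod_indic_fst// /psi.
rewrite -(@fubini_tonelli2 _ _ _ _ _ m3 m2 _ mphi phi0).
by rewrite [X in _ * X](_ : _ = 0) ?mule0.
Qed.

End null_products.

Section dichotomy.
Variables (R : realType) (n m : nat) (s p : R).
Hypotheses (s01 : 0 < s < 1) (p1 : 1 < p).
Local Notation T := (n.-tuple R * m.-tuple R)%type.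
Variables (Om : set 'rV[R]_(n + m)) (lambda : R) (u : T -> R).
Hypotheses (Eu : eigenpair s p Om lambda u) (lE : lambda%:E = lambda1 s p Om).
Local Open Scope ereal_scope.

Definition vball (c : 'rV[R]_(n + m)) (r : R) : set T :=
  [set q | (`|vec_of q - c| < r)%R].

Lemma measurable_vball c r : measurable (vball c r).
Proof.
rewrite (_ : vball c r = ~` [set q | (r <= `|vec_of q - c|)%R]).
  apply: measurableC; apply: measurable_set_ge; exact: measurable_norm_vec_of.
by apply/seteqP; split => q; rewrite /vball /= ltNge => /negP.
Qed.

(* (x, y) with u = 0 and (x', y') with u <> 0 are joined through (x', y): whatever
   the value of u there, one of the two coordinate moves is a jump. *)
Lemma zero_or_nonzero_null c r : (0 < r <= 1)%R -> vball c r `<=` @OmS R n m Om ->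
  mupt R n m ([set q | u q = 0%R] `&` vball c r) = 0 \/
  mupt R n m ([set q | u q != 0%R] `&` vball c r) = 0.
Proof.
move=> r01 BO; have r0 : (0 < r)%R by case/andP : r01.
have mu : measurable_fun setT u by case: Eu => -[].
have mt : measurable_fun setT (tent c r : T -> R) by exact: measurable_tent.
have J := cross_energy_eq0 s01 p1 Eu lE r01 BO.
have df (w : (T * n.-tuple R)%type) : u w.1 = 0%R -> u (sub_fst w) != 0%R ->
    (0 < tdist w.1.1 w.2)%R.
  case: w => -[x y] z /= u0 u1; apply: tdist_gt0 => xz.
  by move: u1; rewrite /sub_fst /= -xz u0 eqxx.
have ds (w : (T * m.-tuple R)%type) : u w.1 = 0%R -> u (sub_snd w) != 0%R ->
    (0 < tdist w.1.2 w.2)%R.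
  case: w => -[x y] z /= u0 u1; apply: tdist_gt0 => xz.
  by move: u1; rewrite /sub_snd /= -xz u0 eqxx.
have [mE1 E1] := jump_set_negligible measurable_fst (@measurable_sub_fst R n m)
  mu mt df (fun h h0 => (J h h0).1).
have [mE2 E2] := jump_set_negligible measurable_snd (@measurable_sub_snd R n m)
  mu mt ds (fun h h0 => (J h h0).2).
set E1' := jump_set _ _ _ in mE1 E1; set E2' := jump_set _ _ _ in mE2 E2.
pose M : {sigma_finite_measure set (T * T)%type -> \bar R} :=
  sfprod (mupt R n m) (mupt R n m).
pose F1 := [set w : (T * T)%type | E1' (w.1, w.2.1)].
pose F2 := [set w : (T * T)%type | E2' ((w.2.1, w.1.2), w.2.2)].
have N1 : M F1 = 0.
  exact: (@null_product_left _ _ _ _ _ _ R (mupt R n m) (tmeas R n) (tmeas R m) _ mE1 E1).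
have N2 : M F2 = 0.
  exact: (@null_product_mid _ _ _ _ _ _ _ _ R (tmeas R n) (tmeas R m) (tmeas R n) (tmeas R m) _ mE2 E2).
set A := _ `&` _; set B := [set q | u q != 0%R] `&` _.
have mZ : measurable [set q | u q = 0%R] by exact: measurable_set_eq0.
have mA : measurable A by apply: measurableI => //; exact: measurable_vball.
have mB : measurable B.
  apply: measurableI; last exact: measurable_vball.
  rewrite (_ : mkset _ = ~` [set q | u q = 0%R]); first exact: measurableC.
  by apply/seteqP; split => q /= /eqP.
suff : mupt R n m A * mupt R n m B = 0.
  by move/eqP; rewrite mule_eq0 => /orP[]/eqP; [left|right].
have <- : M (A `*` B) = mupt R n m A * mupt R n m B by exact: sfprod_setX.
clearbody M.
have mF1 : measurable F1.
  have mg : measurable_fun setT (fun w : (T * T)%type => (w.1, w.2.1)).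
    apply: measurable_fun_pair => //.
    exact: (measurableT_comp measurable_fst measurable_snd).
  by have := mg measurableT _ mE1; rewrite setTI.
have mF2 : measurable F2.
  have mg : measurable_fun setT (fun w : (T * T)%type => ((w.2.1, w.1.2), w.2.2)).
    apply: measurable_fun_pair; last exact: (measurableT_comp measurable_snd measurable_snd).
    apply: measurable_fun_pair; first exact: (measurableT_comp measurable_fst measurable_snd).
    exact: (measurableT_comp measurable_snd measurable_fst).
  by have := mg measurableT _ mE2; rewrite setTI.
have NF : M.-negligible (F1 `|` F2).
  apply: negligibleU; first by exists F1; split => //; exact: mF1.
  by exists F2; split => //; exact: mF2.
apply: (measure_negligible (measurableX mA mB)); move: NF; apply: negligibleS.
move=> [[x y] [x' y']] [[/= u0 b1] [/= u1 b2]].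
have [Ix Jy] := (norm_vec_of_ltP c (x, y) r0).1 b1.
have [Ix' Jy'] := (norm_vec_of_ltP c (x', y') r0).1 b2.
(* The intermediate point stays in the ball because the ball is a product of cubes. *)
have bm : (`|vec_of (x', y) - c| < r)%R by apply/norm_vec_of_ltP.
have [um|um] := eqVneq (u (x', y)) 0%R.
  by right; split => //=; split => //; rewrite tent_gt0.
by left; split => //=; split => //; rewrite tent_gt0.
Qed.


End dichotomy.

(** * From balls to the whole domain *)

Section local_to_global.
Variables (R : realType) (n m : nat).
Local Notation T := (n.-tuple R * m.-tuple R)%type.
Variable Om : set 'rV[R]_(n + m).
Hypothesis oOm : open Om.
Implicit Types (X : set T) (c : 'rV[R]_(n + m)) (r : R).

Lemma open_ball_sub c : Om c -> exists2 r, 0 < r & forall v, `|v - c| < r -> Om v.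
Proof.
move=> Oc; have /nbhs_ballP[r /= r0 rO] : nbhs c Om by exact: open_nbhs_nbhs.
by exists r => // v vc; apply: rO; rewrite -ball_normE /= distrC.
Qed.

Lemma vball_sub c c' r r' : `|c - c'| + r <= r' -> @vball R n m c r `<=` vball c' r'.
Proof.
move=> h q; rewrite /vball /= => qc.
rewrite -(subrK c (vec_of q)) -addrA (le_lt_trans (ler_normD _ _))//; lra.
Qed.

Lemma rat_approx c r : 0 < r ->
  exists c' : 'rV[rat]_(n + m), `|c - map_mx ratr c'| < r.
Proof.
move=> r0.
have /choice[f Hf] : forall i, exists x : rat, `|c 0 i - ratr x| < r.
  move=> i; have [x] := @rat_in_itvoo R (c 0 i - r) (c 0 i + r) ltac:(lra).
  rewrite in_itv/= => /andP[h1 h2]; exists x.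
  by rewrite ltr_norml; apply/andP; split; lra.
exists (\row_i f i); apply/norm_rV_ltP => // i; rewrite [X in `|X|]mxE [X in _ + X]mxE.
by rewrite [X in _ - X]mxE [X in ratr X]mxE.
Qed.

Local Open Scope ereal_scope.

Definition locally_null X : set 'rV[R]_(n + m) :=
  [set c | Om c /\ exists2 r, (0 < r)%R & mupt R n m (X `&` vball c r) = 0].

Let null_sub X c c' r r' : measurable X -> (`|c - c'| + r <= r')%R ->
  mupt R n m (X `&` vball c' r') = 0 -> mupt R n m (X `&` vball c r) = 0.
Proof.
move=> mX h N; apply/eqP; rewrite eq_le measure_ge0 andbT -N.
apply: le_measure; rewrite ?inE; try by apply: measurableI => //; exact: measurable_vball.
exact: setIS (vball_sub h).
Qed.

Lemma open_locally_null X : measurable X -> open (locally_null X).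
Proof.
move=> mX; rewrite openE => c [Oc [r r0 N]].
have [r1 r10 Or1] := open_ball_sub Oc.
apply/nbhs_ballP; exists (Num.min r r1); first by rewrite /= lt_min r0.
move=> v; rewrite -ball_normE /= lt_min => /andP[h1 h2].
split; first by apply: Or1; rewrite distrC.
exists (r - `|c - v|)%R; first by rewrite subr_gt0.
by apply: null_sub N => //; rewrite [(`|v - c|)%R]distrC addrC subrK.
Qed.

(** Otherwise a small ball would be covered by two null sets, although its volume is positive. *)
Lemma locally_null_disjoint X Y c : measurable X -> measurable Y ->
  X `|` Y = setT -> locally_null X c -> ~ locally_null Y c.
Proof.
move=> mX mY XY [_ [r r0 NX]] [_ [r' r'0 NY]].
pose e := Num.min r r'.
have e0 : (0 < e)%R by rewrite lt_min r0.
have {}NX : mupt R n m (X `&` vball c e) = 0.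
  by apply: null_sub NX => //; rewrite subrr normr0 add0r ge_min lexx.
have {}NY : mupt R n m (Y `&` vball c e) = 0.
  by apply: null_sub NY => //; rewrite subrr normr0 add0r ge_min lexx orbT.
have mB := @measurable_vball R n m c e.
have : mupt R n m (vball c e) = 0.
  rewrite (_ : vball c e = (X `&` vball c e) `|` (Y `&` vball c e)).
    by apply: null_set_setU => //; exact: measurableI.
  by rewrite -setIUl XY setTI.
have -> : vball c e = box (cfst c) e `*` box (csnd c) e.
  apply/seteqP; split => q; first by move/(norm_vec_of_ltP c q e0).
  by move=> h; apply/(norm_vec_of_ltP c q e0).
rewrite [mupt R n m _]sfprod_setX; [|exact: measurable_box..].
rewrite !tmeas_box ?(ltW e0)// => /eqP; rewrite -EFinM eqe.
by rewrite gt_eqF// mulr_gt0// exprn_gt0// pmulrn_rgt0.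
Qed.

(** A Lindelof argument: countably many balls with rational centres and radii [1 / (k + 1)] on which
    [X] is null cover the domain. *)
Lemma locally_null_null X : measurable X -> Om `<=` locally_null X ->
  leb_nm ([set q | OmS Om q] `&` X) = 0.
Proof.
move=> mX H.
pose B (w : 'rV[rat]_(n + m) * nat) : set T := vball (map_mx ratr w.1) w.2.+1%:R^-1.
pose good w := B w `<=` [set q | OmS Om q] /\ mupt R n m (X `&` B w) = 0.
(* Codes that decode to no ball, or to a ball that is not good, contribute the empty set. *)
pose F (i : nat) : set T := if unpickle i is Some w then
  (if `[< good w >] then X `&` B w else set0) else set0.
have mB w : measurable (B w) by exact: measurable_vball.
have mF i : measurable (F i).
  rewrite /F; case: unpickle => [w|]; last exact: measurable0.
  by case: ifP => _; [exact: measurableI|exact: measurable0].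
have F0 i : mupt R n m (F i) = 0.
  rewrite /F; case: unpickle => [w|]; last exact: measure0.
  by case: ifP => [/asboolP[]//|_]; exact: measure0.
have -> : [set q | OmS Om q] `&` X = \bigcup_i F i.
  apply/seteqP; split => [q [Oq Xq]|q [i _]]; last first.
    rewrite /F; case: unpickle => [w|//]; case: ifP => // /asboolP[BO _] [Xq Bq].
    by split => //; exact: BO.
  have [r1 r10 Or1] := open_ball_sub Oq.
  have [_ [r2 r20 N]] := H _ Oq.
  (* Half of the smaller radius: a ball of radius below it, with centre at less than its own radius
     from [q], stays inside both given balls around [q]. *)
  have e0 : (0 < Num.min r1 r2 / 2)%R by rewrite divr_gt0// lt_min r10.
  have [k _ hk] := near_infty_natSinv_lt (PosNum e0).
  have {hk} := hk k (leqnn k); rewrite /= ltr_pdivlMr// lt_min => /andP[k1 k2].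
  have k0 : (0 < k.+1%:R^-1 :> R)%R by rewrite invr_gt0.
  have [c' Hc'] := rat_approx (vec_of q) k0.
  exists (pickle (c', k)) => //; rewrite /F pickleK; case: asboolP => [_|[]].
    by split => //; rewrite /B.
  split.
    move=> z Bz; apply: Or1.
    apply: (@vball_sub (map_mx ratr c') (vec_of q) (k.+1%:R^-1) r1 _ z Bz).
    by rewrite distrC (le_trans _ (ltW k1))// mulr_natr mulr2n lerD2r ltW.
  apply: null_sub N => //.
  by rewrite distrC (le_trans _ (ltW k2))// mulr_natr mulr2n lerD2r ltW.
rewrite leb_nmE; last exact: bigcupT_measurable.
apply: measure_negligible; first exact: bigcupT_measurable.
by apply: negligible_bigcup => i; exists (F i); split; [exact: mF|exact: F0|exact: subset_refl].
Qed.

End local_to_global.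

(** * Positivity almost everywhere of first eigenfunctions *)

Unset Implicit Arguments.

Theorem theorem3p6 (R : realType) (n m : nat) (Om : set 'rV[R]_(n + m))
  (s p : R) (u : pt R n m -> R) (lambda : R) :
  (0 < n)%N -> (0 < m)%N ->
  bounded_lipschitz_domain Om ->
  0 < s < 1 -> 1 < p ->
  eigenpair s p Om lambda u ->
  lambda%:E = lambda1 s p Om ->
  leb_nm [set q | OmS Om q /\ u q = 0] = 0%E.
Proof.
move=> _ _ [_ [oOm [cOm _]]] s01 p1 Eu lE.
have [[mu [_ [_ u0]]] [unz _]] := Eu.
pose Z := [set q | u q = 0]; pose P := [set q | u q != 0].
have mZ : measurable Z by exact: measurable_set_eq0.
have PZ : P = ~` Z by apply/seteqP; split => q /= /eqP.
have mP : measurable P by rewrite PZ; exact: measurableC.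
have cover c : Om c -> locally_null Om Z c \/ locally_null Om P c.
  move=> Oc; have [r r0 Or] := open_ball_sub oOm Oc.
  pose e := Num.min r 1.
  have e01 : 0 < e <= 1 by rewrite lt_min r0 ltr01 ge_min lexx orbT.
  have BO : vball c e `<=` @OmS R n m Om.
    by move=> q; rewrite /vball /= lt_min => /andP[h _]; exact: Or.
  case: (zero_or_nonzero_null s01 p1 Eu lE e01 BO) => N; [left|right].
    by split => //; exists e => //; case/andP : e01.
  by split => //; exists e => //; case/andP : e01.
have disj c : locally_null Om Z c -> ~ locally_null Om P c.
  by apply: locally_null_disjoint => //; rewrite PZ setUv.
apply: (locally_null_null oOm mZ) => c Oc.
have [//|Pc] := cover c Oc; exfalso; apply: unz.
(* The set is nonempty, open, and relatively closed in [Om] as the complement of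
   [locally_null Om Z]; connectedness makes it all of [Om]. *)
have PE : locally_null Om P = Om.
  apply: cOm; first by exists c.
    exists (locally_null Om P); first exact: open_locally_null.
    by apply/seteqP; split => x Px; [split; [exact: Px.1|exact: Px]|exact: Px.2].
  exists (~` locally_null Om Z); first exact/open_closedC/open_locally_null.
  apply/seteqP; split => [x Px|x [Ox nZ]].
    by split; [case: Px|move=> /disj].
  by have [Zx|Px] := cover x Ox; [exfalso; exact: nZ|exact: Px].
(* Then [u] vanishes almost everywhere in [Om], and everywhere outside it, which contradicts that an
   eigenfunction is not almost everywhere zero. *)
have := @locally_null_null R n m Om oOm P mP; rewrite PE => /(_ (@subset_refl _ _)).
rewrite /ae_zero (_ : _ `&` _ = P)//.
apply/seteqP; split => [q []//|q Pq]; split => //=.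
by apply: contrapT => /u0 h; move: Pq; rewrite /P /= h eqxx.
Qed.
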